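(* Let $k,\ell,m,n$ be positive integers with $m>1$ and $\gcd(n,m)=1$, and let $\Psi(x)$, $\Theta_2(x)$ be the polynomials defined in the context. Primes denote $d/dx$. The following differential relations hold: $$x(x-1)\left(\Psi'^2-2\Psi''\Psi\right)+\big((2k-3)x-2k+1\big)\Psi'\Psi=\left((k+\ell)(k-\ell-1)-\frac{n^2}{m^2(x-1)}\right)\Psi^2+\frac{n^2\,\Psi(1)^2\,x^{2k}}{m^2(x-1)},$$ $$\frac{d^3\Psi}{dx^3}=3\left(\frac{k-\frac12}{x}-\frac1{x-1}\right)\frac{d^2\Psi}{dx^2}-\left(\frac{k(2k-1)}{x^2}+\frac{m^2-n^2}{m^2(x-1)^2}+\frac{k^2-\ell^2-5k-\ell+2+n^2/m^2}{x(x-1)}\right)\frac{d\Psi}{dx}$$ $$\qquad+\frac{(k+\ell)(k-\ell-1)(2k-1)x-2k\big((k+\ell)(k-\ell-1)+n^2/m^2\big)}{2x^2(x-1)^2}\,\Psi,$$ $$\frac{\Theta_2''}{\Theta_2}+\left(\frac{k+\frac32}{x}-\frac{n-1}{x-1}-\frac{(m-1)\Psi'}{\Psi}\right)\frac{\Theta_2'}{\Theta_2}+\frac{m(m-1)}2\frac{\Psi''}{\Psi}-\frac{m-1}4\left(\frac{m(2k-1)+4k+2}{x}-\frac{2(m+n)}{x-1}\right)\frac{\Psi'}{\Psi}$$ $$\qquad+\frac{m^2(k+\ell)(k-\ell-1)+(n-2)(n-2k-1)}{4x(x-1)}=0 .$$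
   Context: $(x)_j=x(x+1)\cdots(x+j-1)$ is the Pochhammer symbol. Define $$F_3\!\left(\left.{u_1,u_2;v_1,v_2\atop b}\right|x,y\right)=\sum_{p,q\ge0}\frac{(u_1)_p(u_2)_q(v_1)_p(v_2)_q}{(b)_{p+q}\,p!\,q!}x^py^q,$$ $$F^{1:2;2}_{2:0;0}\!\left(\left.{a;u_1,u_2;v_1,v_2\atop b;\,c}\right|x,y\right)=\sum_{p,q\ge0}\frac{(a)_{p+q}(u_1)_p(u_2)_q(v_1)_p(v_2)_q}{(b)_{p+q}(c)_{p+q}\,p!\,q!}x^py^q ;$$ both are used with $v_1=-k$, $v_2=-\ell$, so they are finite sums. The polynomials $\Theta_1(x),\Theta_2(x)$ in $x$ are defined by $$(1+\sqrt x)^nG(\sqrt x)^m=\Theta_1(x)+x^{k+\frac12}\Theta_2(x),\qquad G(\sqrt x)=x^{k/2}F_3\!\left(\left.{k+1,\ell+1;-k,-\ell\atop1+\frac nm}\right|\frac{\sqrt x+1}{2\sqrt x},\frac{1+\sqrt x}2\right)$$ ($G$ is a polynomial in $\sqrt x$, and the left-hand side has such a decomposition). The polynomial $\Psi(x)$ is $$\Psi(x)=\frac{(-1)^\ell\left(1+\frac nm\right)_{k+\ell}\left(1-\frac nm\right)_{k+\ell}\left(\frac{1-k-\ell}2-\frac n{2m}\right)_\ell}{4^{k+\ell}\left(\frac{1+k-\ell}2-\frac n{2m}\right)_\ell}\;x^k\,F^{1:2;2}_{2:0;0}\!\left(\left.{\frac12;\,k+1,\ell+1;\,-k,-\ell\atop1+\frac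 nm;\,1-\frac nm}\right|1-\frac1x,\,1-x\right).$$ *)

(* Defs.v *)
From HB Require Import structures.
From mathcomp Require Import all_boot all_order all_algebra.

Set Implicit Arguments.
Unset Strict Implicit.
Unset Printing Implicit Defensive.

Import Order.TTheory GRing.Theory Num.Theory.
Local Open Scope ring_scope.

Notation "p %:F" := (@FracField.tofrac _ p) : ring_scope.

Section Hypergeometric.
Variable K : fieldType.
Implicit Types (a b c u v x y : K) (p q k l : nat).

Definition pochhammer x p : K := \prod_(i < p) (x + i%:R).

Definition F3_coef u1 u2 v1 v2 b p q : K :=
  pochhammer u1 p * pochhammer u2 q * pochhammer v1 p * pochhammer v2 q
  / (pochhammer b (p + q) * p`!%:R * q`!%:R).

Definition F122_coef a u1 u2 v1 v2 b c p q : K :=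
  pochhammer a (p + q)
  * pochhammer u1 p * pochhammer u2 q * pochhammer v1 p * pochhammer v2 q
  / (pochhammer b (p + q) * pochhammer c (p + q) * p`!%:R * q`!%:R).

(* F_3 and F^{1:2;2}_{2:0;0} at v1 = -k, v2 = -l: the terms with p > k or
   q > l vanish. *)
Definition F3 u1 u2 k l b x y : K :=
  \sum_(p < k.+1) \sum_(q < l.+1)
    F3_coef u1 u2 (- k%:R) (- l%:R) b p q * x ^+ p * y ^+ q.

Definition F122 a u1 u2 k l b c x y : K :=
  \sum_(p < k.+1) \sum_(q < l.+1)
    F122_coef a u1 u2 (- k%:R) (- l%:R) b c p q * x ^+ p * y ^+ q.

End Hypergeometric.

Section Polynomials.
Variables (F : numFieldType) (k l m n : nat).
Local Notation nm := (n%:R / m%:R).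

(* G as a polynomial in the indeterminate s = sqrt x: the factor
   x^(k/2) = s^k is distributed over the terms of F_3; see GpolyE. *)
Definition Gpoly : {poly F} :=
  \sum_(p < k.+1) \sum_(q < l.+1)
    F3_coef k.+1%:R l.+1%:R (- k%:R) (- l%:R) (1 + nm) p q
    *: ('X ^+ (k - p) * (2^-1 *: ('X + 1)) ^+ p * (2^-1 *: (1 + 'X)) ^+ q).

Definition Psi_prefactor : F :=
  (-1) ^+ l * pochhammer (1 + nm) (k + l) * pochhammer (1 - nm) (k + l)
  * pochhammer ((1 - k%:R - l%:R) / 2 - n%:R / (2 * m%:R)) l
  / (4 ^+ (k + l)
     * pochhammer ((1 + k%:R - l%:R) / 2 - n%:R / (2 * m%:R)) l).

(* The factor x^k is distributed over the terms of F^{1:2;2}_{2:0;0};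
   see PsiE. *)
Definition Psi : {poly F} :=
  Psi_prefactor *:
  \sum_(p < k.+1) \sum_(q < l.+1)
    F122_coef 2^-1 k.+1%:R l.+1%:R (- k%:R) (- l%:R) (1 + nm) (1 - nm) p q
    *: ('X ^+ (k - p) * ('X - 1) ^+ p * (1 - 'X) ^+ q).

(* (1 + sqrt x)^n G(sqrt x)^m = Theta1(x) + x^(k+1/2) Theta2(x), as an
   identity of polynomials in s = sqrt x. *)
Definition Theta_decomposition (Theta1 Theta2 : {poly F}) : Prop :=
  (1 + 'X) ^+ n * Gpoly ^+ m
  = (Theta1 \Po 'X^2) + 'X ^+ (2 * k + 1) * (Theta2 \Po 'X^2).

Lemma Theta_decomposition_uniq T1 T2 U1 U2 :
  Theta_decomposition T1 T2 -> Theta_decomposition U1 U2 ->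
  T1 = U1 /\ T2 = U2.
Proof.
rewrite /Theta_decomposition => -> eqTU.
have evenE (T1' T2' : {poly F}) i :
  ((T1' \Po 'X^2) + 'X ^+ (2 * k + 1) * (T2' \Po 'X^2))`_(i * 2) = T1'`_i.
  rewrite coefD coefXnM !coef_comp_poly_Xn // dvdn_mull // mulnK //.
  case: ifP => [_|/negbT]; rewrite ?addr0 // -leqNgt => lei.
  rewrite dvdn_subr ?dvdn_mull //.
  by rewrite dvdn_addr ?dvdn_mulr // addr0.
have oddE (T1' T2' : {poly F}) i :
  ((T1' \Po 'X^2) + 'X ^+ (2 * k + 1) * (T2' \Po 'X^2))`_(2 * k + 1 + i * 2)
  = T2'`_i.
  rewrite coefD coefXnM !coef_comp_poly_Xn // ltnNge leq_addr /= addKn.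
  rewrite dvdn_mull // mulnK // dvdn_addl ?dvdn_mull //.
  by rewrite dvdn_addr ?dvdn_mulr // add0r.
split; apply/polyP => i.
  by rewrite -(evenE T1 T2) -(evenE U1 U2) eqTU.
by rewrite -(oddE T1 T2) -(oddE U1 U2) eqTU.
Qed.

End Polynomials.

Lemma rmorph_pochhammer (K L : fieldType) (f : {rmorphism K -> L}) x p :
  f (pochhammer x p) = pochhammer (f x) p.
Proof.
rewrite rmorph_prod; apply: eq_bigr => i _.
by rewrite rmorphD rmorph_nat.
Qed.

Section Evaluation.
Variables (F : numFieldType) (K : fieldType) (f : {rmorphism {poly F} -> K}).
Variables (k l m n : nat).
Hypothesis fX_neq0 : f 'X != 0.
Local Notation nm := (n%:R / m%:R).
Local Notation iota := (f \o polyC).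
Local Notation s := (f 'X).

Let f_scale (c : F) (P : {poly F}) : f (c *: P) = iota c * f P.
Proof. by rewrite -mul_polyC rmorphM. Qed.

Let powB p : (p < k.+1)%N -> s ^+ (k - p) = s ^+ k / s ^+ p.
Proof. by rewrite ltnS => lepk; rewrite expfB_cond // (negbTE fX_neq0). Qed.

Lemma rmorph_Gpoly :
  f (Gpoly F k l m n)
  = s ^+ k * F3 k.+1%:R l.+1%:R k l (1 + nm) ((s + 1) / (2 * s)) ((1 + s) / 2).
Proof.
have coefE p q : iota (F3_coef k.+1%:R l.+1%:R (- k%:R) (- l%:R) (1 + nm) p q)
               = F3_coef k.+1%:R l.+1%:R (- k%:R) (- l%:R) (1 + nm) p q.
  rewrite /F3_coef fmorph_div !(rmorphM, rmorph_pochhammer).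
  by rewrite !(rmorphN, rmorphD, rmorph1, rmorph_nat, fmorph_div).
have halfE : iota 2^-1 = 2^-1 by rewrite fmorphV rmorph_nat.
rewrite /Gpoly /F3 rmorph_sum big_distrr; apply: eq_bigr => p _.
rewrite rmorph_sum big_distrr; apply: eq_bigr => q _.
rewrite f_scale coefE !rmorphM !rmorphXn !f_scale halfE !rmorphD !rmorph1.
rewrite powB //; move: (F3_coef _ _ _ _ _ _ _) => c.
rewrite -[RHS]/(s ^+ k * _) !mulrA [s ^+ k * c]mulrC; congr (_ * _); last first.
  by rewrite [2^-1 * _]mulrC.
rewrite -!mulrA; congr (_ * (_ * _)).
by rewrite -exprVn -exprMn; congr (_ ^+ _); rewrite mulrA -invfM mulrC [s * 2]mulrC.
Qed.

Lemma rmorph_Psi :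
  f (Psi F k l m n)
  = iota (Psi_prefactor F k l m n) * s ^+ k
    * F122 2^-1 k.+1%:R l.+1%:R k l (1 + nm) (1 - nm) (1 - s^-1) (1 - s).
Proof.
have coefE p q :
    iota (F122_coef 2^-1 k.+1%:R l.+1%:R (- k%:R) (- l%:R)
            (1 + nm) (1 - nm) p q)
  = F122_coef 2^-1 k.+1%:R l.+1%:R (- k%:R) (- l%:R) (1 + nm) (1 - nm) p q.
  rewrite /F122_coef fmorph_div !(rmorphM, rmorph_pochhammer).
  by rewrite !(rmorphN, rmorphB, rmorphD, rmorph1, rmorph_nat, fmorph_div,
               fmorphV).
rewrite /Psi f_scale -mulrA; congr (_ * _).
rewrite /F122 rmorph_sum big_distrr; apply: eq_bigr => p _.
rewrite rmorph_sum big_distrr; apply: eq_bigr => q _.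
rewrite f_scale coefE !rmorphM !rmorphXn !rmorphB !rmorph1.
rewrite powB //; move: (F122_coef _ _ _ _ _ _ _ _ _) => c.
rewrite -[RHS]/(s ^+ k * _) !mulrA [s ^+ k * c]mulrC; congr (_ * _).
rewrite -!mulrA; congr (_ * (_ * _)).
by rewrite -exprVn -exprMn mulrBr mulVf // mulr1.
Qed.

End Evaluation.

(* The defining formulas of G and Psi, as identities in F(s) and F(x). *)
Lemma GpolyE (F : numFieldType) (k l m n : nat)
    (s := ('X : {poly F})%:F) (nm := n%:R / m%:R) :
  (Gpoly F k l m n)%:F
  = s ^+ k * F3 k.+1%:R l.+1%:R k l (1 + nm) ((s + 1) / (2 * s)) ((1 + s) / 2).
Proof. by apply: rmorph_Gpoly; rewrite tofrac_eq0 polyX_eq0. Qed.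

Lemma PsiE (F : numFieldType) (k l m n : nat)
    (x := ('X : {poly F})%:F) (nm := n%:R / m%:R) :
  (Psi F k l m n)%:F
  = (Psi_prefactor F k l m n)%:P%:F * x ^+ k
    * F122 2^-1 k.+1%:R l.+1%:R k l (1 + nm) (1 - nm) (1 - x^-1) (1 - x).
Proof. by apply: rmorph_Psi; rewrite tofrac_eq0 polyX_eq0. Qed.

(* Main.v *)
Require Import Defs.
From HB Require Import structures.
From mathcomp Require Import all_boot all_order all_algebra.
From mathcomp Require Import ring.

Set Implicit Arguments.
Unset Strict Implicit.
Unset Printing Implicit Defensive.

Import Order.TTheory GRing.Theory Num.Theory.
Local Open Scope ring_scope.

(** Write s for the square root of x, alpha = n/m, G for the polynomial G(s)
    and H(s) = G(-s).  Up to powers of x and constants, (1 + s)^alpha G(s) and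
    (1 - s)^alpha H(s) are two solutions of one second order Fuchsian equation
    in x with dihedral monodromy, and Psi(x) is their product divided by
    (1 - x)^alpha.  All three relations come from this picture.

    The second order equation.  G is a double sum of terms
    c_pq s^(k-p) (s + 1)^(p+q); an explicit creative-telescoping certificate
    shows that G is a solution of
      s (1 - s^2) G'' + 2 (alpha s - k + (k - 1) s^2) G'
        + ((l (l + 1) - k (k - 1)) s - 2 alpha k) G = 0
    (G_sum_ode, Gpoly_ode).  Replacing s by -s, H is a solution of the same
    equation with -alpha in place of alpha (dihedral_op_opp).

    The third order equation.  Psi is also a double sum of products of powers
    of x and x - 1, and another certificate shows that it solves the third
    order equation of the theorem (Psi_sum_ode, Psi_ode).  That certificate
    proves the equation times 4 alpha^2 - 1, so alpha = 1/2 has a certificate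
    of its own.  The quadratic relation is a first integral of the third order
    one (psi_first_integral); the constant is found at x = 1.

    Identification of Psi with G H.  Written in the variable s, the third
    order equation is, up to the factor (1 - x)^alpha, the symmetric square of
    the second order one, hence is solved by G H (dihedral_product).  Its
    exponents at s = 1 are 0, alpha and -alpha, and alpha is not an integer
    since n and m > 1 are coprime; therefore a polynomial solution is
    determined by its value at 1 (psi_op_sqrt_uniq), and G H is a
    nonzero multiple of Psi(s^2) (G_mul_H).

    The equation for Theta_2.  The polynomials V_1 = (1 + s)^n G^m and
    V_2 = (1 - s)^n H^m are the m-th powers of the two solutions, and
    V_1 - V_2 = 2 s^(2k+1) Theta_2(s^2).  If r_1 and r_2 are the logarithmic
    derivatives of the two solutions, V_1 and V_2 satisfy one linear second
    order equation whose coefficients involve r_1 and r_2 through the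
    symmetric functions r_1 + r_2 and r_1 r_2 only; these are expressed by
    Psi'/Psi and Psi''/Psi (dihedral_power).  Dividing by s^(2k+1) gives the
    last relation (theta_form_eq0).

    Algebraic identities between functions and their derivatives are checked
    in an arbitrary field K that receives an injective ring morphism f from
    the polynomials; K is the field of rational functions only in the last
    step. *)

(** * Creative telescoping for double sums *)

(** A certificate (A, B) writes the summand L t as a sum of two differences,
    one in p and one in q.  The vanishing of t at k + 1 and l + 1, and the
    factors p and q in the telescoped terms, kill all boundary terms.  The
    certificate is an identity in indeterminate p and q: the ratios of
    neighbouring terms of the hypergeometric t have been divided out. *)
Lemma creative_telescoping (K : fieldType) (k l : nat) (X Y : K)
    (den num : K -> K) (A B L : K -> K -> K) (t : nat -> nat -> K) :
  (forall q, t k.+1 q = 0) -> (forall p, t p l.+1 = 0) ->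
  (forall p q, p.+1%:R * den (p%:R + q%:R + 1) * t p.+1 q
     = num (p%:R + q%:R) * (p%:R + k%:R + 1) * (p%:R - k%:R) * X * t p q) ->
  (forall p q, q.+1%:R * den (p%:R + q%:R + 1) * t p q.+1
     = num (p%:R + q%:R) * (q%:R + l%:R + 1) * (q%:R - l%:R) * Y * t p q) ->
  (forall p q, L p q
     = X * num (p + q) * (p + k%:R + 1) * (p - k%:R) * A (p + 1) q
       - p * den (p + q) * A p q
       + Y * num (p + q) * (q + l%:R + 1) * (q - l%:R) * B p (q + 1)
       - q * den (p + q) * B p q) ->
  \sum_(p < k.+1) \sum_(q < l.+1) L p%:R q%:R * t p q = 0.
Proof.
move=> tk tl recp recq cert.
pose U p q := p%:R * den (p%:R + q%:R) * A p%:R q%:R * t p q.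
pose V p q := q%:R * den (p%:R + q%:R) * B p%:R q%:R * t p q.
have LE p q : L p%:R q%:R * t p q = (U p.+1 q - U p q) + (V p q.+1 - V p q).
  have -> : U p.+1 q = A (p%:R + 1) q%:R *
      (p.+1%:R * den (p%:R + q%:R + 1) * t p.+1 q).
    rewrite /U -natr1; set P : K := p%:R; set Q : K := q%:R.
    have -> : P + 1 + Q = P + Q + 1 by ring.
    by ring.
  have -> : V p q.+1 = B p%:R (q%:R + 1) *
      (q.+1%:R * den (p%:R + q%:R + 1) * t p q.+1).
    rewrite /V -natr1; set P : K := p%:R; set Q : K := q%:R.
    have -> : P + (Q + 1) = P + Q + 1 by ring.
    by ring.
  by rewrite recp recq cert /U /V; ring.
transitivity (\sum_(p < k.+1) \sum_(q < l.+1) (U p.+1 q - U p q)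
            + \sum_(p < k.+1) \sum_(q < l.+1) (V p q.+1 - V p q)).
  rewrite -big_split; apply: eq_bigr => p _; rewrite -big_split.
  by apply: eq_bigr => q _; rewrite LE.
rewrite exchange_big /= !big1 ?addr0 // => i _.
  rewrite -(big_mkord xpredT (fun q => V i q.+1 - V i q)) telescope_sumr //.
  by rewrite /V tl !(mulr0, mul0r) subrr.
rewrite -(big_mkord xpredT (fun p => U p.+1 i - U p i)) telescope_sumr //.
by rewrite /U tk !(mulr0, mul0r) subrr.
Qed.

(** * Coefficients of the hypergeometric sums *)

Lemma pochhammerS (K : fieldType) (x : K) p :
  pochhammer x p.+1 = pochhammer x p * (x + p%:R).
Proof. by rewrite /pochhammer big_ord_recr. Qed.

Lemma pochhammer_neq0 (K : fieldType) (x : K) p :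
  (forall i : nat, x + i%:R != 0) -> pochhammer x p != 0.
Proof. by move=> x_neq0; apply/prodf_neq0. Qed.

Lemma pochhammer_negn_eq0 (K : fieldType) (k p : nat) :
  (k < p)%N -> pochhammer (- k%:R : K) p = 0.
Proof.
move=> ltkp; apply/eqP/prodf_eq0; exists (Ordinal ltkp) => //=.
by rewrite addNr.
Qed.

Lemma fact_neq0 (F : numFieldType) p : (p`!%:R : F) != 0.
Proof. by rewrite pnatr_eq0 -lt0n fact_gt0. Qed.

Section CoefRec.
Variables (F : numFieldType) (k l : nat) (b c a : F).
Hypothesis b_neq0 : forall i : nat, b + i%:R != 0.
Hypothesis c_neq0 : forall i : nat, c + i%:R != 0.
Let C3 := F3_coef k.+1%:R l.+1%:R (- k%:R) (- l%:R) b.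
Let C4 := F122_coef a k.+1%:R l.+1%:R (- k%:R) (- l%:R) b c.

Let bp i : pochhammer b i != 0. Proof. exact: pochhammer_neq0. Qed.
Let cp i : pochhammer c i != 0. Proof. exact: pochhammer_neq0. Qed.

Let b_shift_neq0 p q : b + (p%:R + q%:R) != 0. Proof. by rewrite -natrD. Qed.
Let c_shift_neq0 p q : c + (p%:R + q%:R) != 0. Proof. by rewrite -natrD. Qed.
Let nat1r_neq0 p : 1 + p%:R != 0 :> F. Proof. by rewrite nat1r pnatr_eq0. Qed.
Let nz := (fact_neq0, bp, cp, b_shift_neq0, c_shift_neq0, nat1r_neq0).

Lemma F3_coef_recl p q :
  p.+1%:R * (b + (p + q)%:R) * C3 p.+1 q
  = (p%:R + k%:R + 1) * (p%:R - k%:R) * C3 p q.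
Proof.
rewrite /C3 /F3_coef addSn !pochhammerS factS.
by field; rewrite !nz.
Qed.

Lemma F3_coef_recr p q :
  q.+1%:R * (b + (p + q)%:R) * C3 p q.+1
  = (q%:R + l%:R + 1) * (q%:R - l%:R) * C3 p q.
Proof.
rewrite /C3 /F3_coef addnS !pochhammerS factS.
by field; rewrite !nz.
Qed.

Lemma F122_coef_recl p q :
  p.+1%:R * (b + (p + q)%:R) * (c + (p + q)%:R) * C4 p.+1 q
  = (a + (p + q)%:R) * (p%:R + k%:R + 1) * (p%:R - k%:R) * C4 p q.
Proof.
rewrite /C4 /F122_coef addSn !pochhammerS factS.
by field; rewrite !nz.
Qed.

Lemma F122_coef_recr p q :
  q.+1%:R * (b + (p + q)%:R) * (c + (p + q)%:R) * C4 p q.+1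
  = (a + (p + q)%:R) * (q%:R + l%:R + 1) * (q%:R - l%:R) * C4 p q.
Proof.
rewrite /C4 /F122_coef addnS !pochhammerS factS.
by field; rewrite !nz.
Qed.
End CoefRec.

Lemma F3_coef_0l (F : numFieldType) (k l : nat) (u1 u2 b : F) q :
  F3_coef u1 u2 (- k%:R) (- l%:R) b k.+1 q = 0.
Proof.
by rewrite /F3_coef [pochhammer (- k%:R) _]pochhammer_negn_eq0 //
  !(mulr0, mul0r).
Qed.

Lemma F3_coef_0r (F : numFieldType) (k l : nat) (u1 u2 b : F) p :
  F3_coef u1 u2 (- k%:R) (- l%:R) b p l.+1 = 0.
Proof.
by rewrite /F3_coef [pochhammer (- l%:R) _]pochhammer_negn_eq0 //
  !(mulr0, mul0r).
Qed.

Lemma F122_coef_0l (F : numFieldType) (k l : nat) (a u1 u2 b c : F) q :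
  F122_coef a u1 u2 (- k%:R) (- l%:R) b c k.+1 q = 0.
Proof.
by rewrite /F122_coef [pochhammer (- k%:R) _]pochhammer_negn_eq0 //
  !(mulr0, mul0r).
Qed.

Lemma F122_coef_0r (F : numFieldType) (k l : nat) (a u1 u2 b c : F) p :
  F122_coef a u1 u2 (- k%:R) (- l%:R) b c p l.+1 = 0.
Proof.
by rewrite /F122_coef [pochhammer (- l%:R) _]pochhammer_negn_eq0 //
  !(mulr0, mul0r).
Qed.

(** * Derivatives of the double sums *)

Lemma deriv_nat (R : nzRingType) n : (n%:R : {poly R})^`() = 0.
Proof. by rewrite -polyC_natr derivC. Qed.

Lemma deriv1 (R : nzRingType) : (1 : {poly R})^`() = 0.
Proof. exact: (deriv_nat R 1). Qed.

Lemma derivn2 (R : nzRingType) (p : {poly R}) : p^`(2) = p^`()^`().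
Proof. by []. Qed.

Lemma derivn3 (R : nzRingType) (p : {poly R}) : p^`(3) = p^`(2)^`().
Proof. by []. Qed.

(** Turns a hypothesis u = v into the goal u' = v' when the cofactor c is known,
    so that what remains is an identity for ring or field. *)
Lemma eq_of_multiple (R : pzRingType) (c u v u' v' : R) :
  u = v -> u' - v' = c * (u - v) -> u' = v'.
Proof. by move=> -> /eqP; rewrite subrr mulr0 subr_eq0 => /eqP. Qed.
Arguments eq_of_multiple {R} c {u v u' v'}.

(** This first order equation determines all derivatives of a monomial in X and
    X - c, without the truncated exponents a - 1, a - 2 that would force a
    separate treatment of small a and b. *)
Lemma deriv_XnXsubCn (F : fieldType) (c : F) a b
    (t : {poly F} := 'X ^+ a * ('X - c%:P) ^+ b) :
  'X * ('X - c%:P) * t^`() = (a%:R * ('X - c%:P) + b%:R * 'X) * t.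
Proof.
rewrite /t derivM !deriv_exp derivXsubC derivX.
by clear t; case: a b => [|a'] [|b'] /=; rewrite ?mulr0n ?expr0 ?exprS; ring.
Qed.

Section LogDeriv.
Variables (F : fieldType) (K : fieldType) (f : {rmorphism {poly F} -> K}).
Variables (c : F) (a b : nat).
Variable t : {poly F}.
Let x : K := f 'X.
Let y : K := f 'X - f c%:P.
Hypothesis x0 : x != 0.
Hypothesis y0 : y != 0.

Hypothesis Ht :
  'X * ('X - c%:P) * t^`() = (a%:R * ('X - c%:P) + b%:R * 'X) * t.

Lemma rmorph_deriv_monomial : f t^`() = (a%:R / x + b%:R / y) * f t.
Proof.
have /(congr1 f) := Ht.
rewrite !(rmorphM, rmorphB, rmorphD, rmorph_nat) -/y -/x.
move: (f t) (f t^`()) => T T1 E.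
apply: (mulfI (mulf_neq0 x0 y0)); apply: (eq_of_multiple 1 E).
by field; rewrite x0 y0.
Qed.

Lemma rmorph_derivn2_monomial : f t^`(2)
  = (a%:R * (a%:R - 1) / x ^+ 2 + 2 * a%:R * b%:R / (x * y)
     + b%:R * (b%:R - 1) / y ^+ 2) * f t.
Proof.
have := congr1 (@deriv F) Ht.
rewrite !(derivM, derivD, derivN, derivX, derivC, deriv_nat).
have -> : t^`()^`() = t^`(2) by [].
rewrite !subr0 => /(congr1 f).
rewrite !(rmorphM, rmorphB, rmorphD, rmorph_nat, rmorph1, rmorph0).
rewrite rmorph_deriv_monomial -/y -/x.
move: (f t) (f t^`(2)) => T T2 E.
apply: (mulfI (mulf_neq0 x0 y0)); apply: (eq_of_multiple 1 E).
by field; rewrite x0 y0.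
Qed.

Lemma rmorph_derivn3_monomial : f t^`(3)
  = (a%:R * (a%:R - 1) * (a%:R - 2) / x ^+ 3
     + 3 * a%:R * (a%:R - 1) * b%:R / (x ^+ 2 * y)
     + 3 * a%:R * b%:R * (b%:R - 1) / (x * y ^+ 2)
     + b%:R * (b%:R - 1) * (b%:R - 2) / y ^+ 3) * f t.
Proof.
have := congr1 (@deriv F) (congr1 (@deriv F) Ht).
rewrite !(derivM, derivD, derivN, derivX, derivC, deriv_nat, deriv0, derivn1).
have -> : t^`()^`() = t^`(2) by [].
have -> : t^`(2)^`() = t^`(3) by [].
rewrite !(subr0, deriv0, derivC) => /(congr1 f).
rewrite !(rmorphM, rmorphB, rmorphD, rmorph_nat, rmorph1, rmorph0).
rewrite rmorph_deriv_monomial rmorph_derivn2_monomial -/y -/x.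
move: (f t) (f t^`(3)) => T T3 E.
apply: (mulfI (mulf_neq0 x0 y0)); apply: (eq_of_multiple 1 E).
by field; rewrite x0 y0.
Qed.
End LogDeriv.

Section DoubleSum.
Variables (F : fieldType) (K : fieldType) (f : {rmorphism {poly F} -> K}).
Variables (k l : nat) (c : F) (C : nat -> nat -> F).
Let x : K := f 'X.
Let y : K := f 'X - f c%:P.
Hypothesis x0 : x != 0.
Hypothesis y0 : y != 0.

(** The common shape of G, with c = -1, and of Psi, with c = 1. *)
Definition double_sum : {poly F} :=
  \sum_(p < k.+1) \sum_(q < l.+1)
    C p q *: ('X ^+ (k - p) * ('X - c%:P) ^+ (p + q)).

Let t p q := f (C p q)%:P * (x ^+ k * (y / x) ^+ p * y ^+ q).

Definition logder1 (p q : K) : K := (k%:R - p) / x + (p + q) / y.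
Definition logder2 (p q : K) : K :=
  (k%:R - p) * (k%:R - p - 1) / x ^+ 2 + 2 * (k%:R - p) * (p + q) / (x * y)
  + (p + q) * (p + q - 1) / y ^+ 2.
Definition logder3 (p q : K) : K :=
  (k%:R - p) * (k%:R - p - 1) * (k%:R - p - 2) / x ^+ 3
  + 3 * (k%:R - p) * (k%:R - p - 1) * (p + q) / (x ^+ 2 * y)
  + 3 * (k%:R - p) * (p + q) * (p + q - 1) / (x * y ^+ 2)
  + (p + q) * (p + q - 1) * (p + q - 2) / y ^+ 3.

Lemma double_sum_derivn i (lam : K -> K -> K) :
  (forall p q : nat, (p <= k)%N ->
    f ('X ^+ (k - p) * ('X - c%:P) ^+ (p + q))^`(i) =
    lam p%:R q%:R * f ('X ^+ (k - p) * ('X - c%:P) ^+ (p + q))) ->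
  f double_sum^`(i) = \sum_(p < k.+1) \sum_(q < l.+1) lam p%:R q%:R * t p q.
Proof.
move=> Hlam; rewrite /double_sum raddf_sum rmorph_sum; apply: eq_bigr => p _.
rewrite raddf_sum rmorph_sum; apply: eq_bigr => q _ /=.
rewrite derivnZ -mul_polyC rmorphM Hlam -1?ltnS // mulrCA; congr (_ * (_ * _)).
rewrite rmorphM !rmorphXn rmorphB -/x -/y expfB_cond ?(negPf x0) -1?ltnS //=.
  by rewrite exprD expr_div_n; field; rewrite expf_neq0.
by rewrite add0n ltn_ord.
Qed.

(** Reduces a linear differential equation for the double sum to one rational
    identity in p and q.  The two variables of the hypergeometric sum are
    r y / x and s y, where y = x - c. *)
Lemma double_sum_ode (A0 A1 A2 A3 : K) (den num : K -> K) (A B : K -> K -> K)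
    (r s : K) :
  (forall q, C k.+1 q = 0) -> (forall p, C p l.+1 = 0) ->
  (forall p q, p.+1%:R * den (p%:R + q%:R + 1) * f (C p.+1 q)%:P
     = num (p%:R + q%:R) * (p%:R + k%:R + 1) * (p%:R - k%:R) * r
       * f (C p q)%:P) ->
  (forall p q, q.+1%:R * den (p%:R + q%:R + 1) * f (C p q.+1)%:P
     = num (p%:R + q%:R) * (q%:R + l%:R + 1) * (q%:R - l%:R) * s
       * f (C p q)%:P) ->
  (forall p q, A0 + A1 * logder1 p q + A2 * logder2 p q + A3 * logder3 p q
     = r * (y / x) * num (p + q) * (p + k%:R + 1) * (p - k%:R) * A (p + 1) q
       - p * den (p + q) * A p q
       + s * y * num (p + q) * (q + l%:R + 1) * (q - l%:R) * B p (q + 1)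
       - q * den (p + q) * B p q) ->
  A0 * f double_sum + A1 * f double_sum^`() + A2 * f double_sum^`(2)
  + A3 * f double_sum^`(3) = 0.
Proof.
move=> Ck Cl recp recq cert.
have E0 : f double_sum = \sum_(p < k.+1) \sum_(q < l.+1) 1 * t p q.
  rewrite -(@double_sum_derivn 0 (fun _ _ => 1)) // => p q _.
  by rewrite mul1r.
have E1 := @double_sum_derivn 1 logder1; rewrite derivn1 in E1.
rewrite {}E1; last first.
  move=> p q lepk.
  rewrite derivn1 (rmorph_deriv_monomial x0 y0 (deriv_XnXsubCn _ _ _)).
  by rewrite natrB // natrD.
rewrite (@double_sum_derivn 2 logder2); last first.
  move=> p q lepk.
  rewrite (rmorph_derivn2_monomial x0 y0 (deriv_XnXsubCn _ _ _)).
  by rewrite natrB // natrD.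
rewrite (@double_sum_derivn 3 logder3); last first.
  move=> p q lepk.
  rewrite (rmorph_derivn3_monomial x0 y0 (deriv_XnXsubCn _ _ _)).
  by rewrite natrB // natrD.
rewrite E0 !big_distrr -!big_split /=.
have tk q : t k.+1 q = 0 by rewrite /t Ck polyC0 rmorph0 mul0r.
have tl p : t p l.+1 = 0 by rewrite /t Cl polyC0 rmorph0 mul0r.
rewrite -[RHS](creative_telescoping tk tl _ _ cert).
- apply: eq_bigr => p _; rewrite !big_distrr -!big_split /=.
  by apply: eq_bigr => q _; ring.
- move=> p q; rewrite /t exprS.
  apply: (eq_of_multiple (y / x * (x ^+ k * (y / x) ^+ p * y ^+ q)) (recp p q)).
  by ring.
move=> p q; rewrite /t exprS.
apply: (eq_of_multiple (y * (x ^+ k * (y / x) ^+ p * y ^+ q)) (recq p q)).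
by ring.
Qed.
End DoubleSum.

(** * The second order equation for G *)

Definition G_coef (F : numFieldType) k l (al : F) p q : F :=
  F3_coef k.+1%:R l.+1%:R (- k%:R) (- l%:R) (1 + al) p q * 2^-1 ^+ (p + q).

Lemma Gpoly_double_sum (F : numFieldType) k l m n :
  Gpoly F k l m n = double_sum k l (-1) (G_coef k l (n%:R / m%:R)).
Proof.
apply: eq_bigr => p _; apply: eq_bigr => q _.
rewrite /G_coef -scalerA; congr (_ *: _).
rewrite polyCN polyC1 opprK [1 + 'X]addrC !exprZn -!scalerAr -!scalerAl scalerA.
by rewrite !exprD [2^-1 ^+ q * _]mulrC mulrA.
Qed.

Section GODE.
Variables (F : numFieldType) (K : fieldType) (f : {rmorphism {poly F} -> K}).
Variables (k l : nat) (al : F).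
Let x : K := f 'X.
Let a : K := f al%:P.
Hypothesis al_neq0 : forall i : nat, 1 + al + i%:R != 0.
Hypothesis x0 : x != 0.
Hypothesis y0 : x + 1 != 0.
Let C := G_coef k l al.

Let K2 : (2 : K) != 0.
Proof. by rewrite -(rmorph_nat (f \o polyC)) fmorph_eq0 pnatr_eq0. Qed.

Let fV2 : f (2^-1)%:P = 2^-1.
Proof. by rewrite -[LHS]/((f \o polyC) _) fmorphV rmorph_nat. Qed.

Let polyCE := (polyCM, polyCB, polyCD, polyC_natr, polyC1,
  rmorphM f, rmorphB f, rmorphD f, rmorph_nat f, rmorph1 f).

(** The certificate comes from the Bessel equation.  Up to elementary factors
    G is formally an integral over tau of u_k(s tau) u_l(tau) against a power
    of tau, where u_j is the solution of u'' = (1 + j (j + 1) / tau^2) u that is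
    exp(-tau) times a polynomial in 1/tau; integrating by parts in tau yields
    the second order equation in s. *)
Lemma G_sum_ode :
  let G := double_sum k l (-1) C in
  ((l%:R * (l%:R + 1) - k%:R * (k%:R - 1)) * x - 2 * a * k%:R) * f G
  + 2 * (a * x - k%:R + (k%:R - 1) * x ^+ 2) * f G^`()
  + x * (1 - x ^+ 2) * f G^`(2) = 0.
Proof.
move=> G; rewrite -[LHS]addr0 -[X in _ + X = 0](mul0r (f G^`(3))).
have yE : f 'X - f (-1)%:P = x + 1.
  by rewrite -rmorphB polyCN polyC1 opprK rmorphD rmorph1.
apply: (@double_sum_ode _ _ f k l (-1) C x0 _ _ _ _ _ (fun N => N + a) (fun=> 1)
  (fun _ _ => 2 / (x + 1)) (fun _ _ => - 2 * x / (x + 1)) 2^-1 2^-1).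
- by rewrite yE.
- by move=> q; rewrite /C /G_coef F3_coef_0l mul0r.
- by move=> q; rewrite /C /G_coef F3_coef_0r mul0r.
- move=> p q; have := F3_coef_recl k l al_neq0 p q.
  move=> /(congr1 (fun z => f z%:P)).
  rewrite /C /G_coef.
  move: (F3_coef _ _ _ _ _ _ _) (F3_coef _ _ _ _ _ _ _) => c1 c0.
  rewrite addSn exprS polyCE => E.
  rewrite !polyCE fV2.
  apply: (eq_of_multiple (2^-1 * f (2^-1 ^+ (p + q))%:P) E); rewrite natrD.
  by ring.
- move=> p q; have := F3_coef_recr k l al_neq0 p q.
  move=> /(congr1 (fun z => f z%:P)).
  rewrite /C /G_coef.
  move: (F3_coef _ _ _ _ _ _ _) (F3_coef _ _ _ _ _ _ _) => c1 c0.
  rewrite addnS exprS polyCE => E.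
  rewrite !polyCE fV2.
  apply: (eq_of_multiple (2^-1 * f (2^-1 ^+ (p + q))%:P) E); rewrite natrD.
  by ring.
move=> p q; rewrite /logder1 /logder2 /logder3 yE -/x.
by field; rewrite K2 x0 y0.
Qed.
End GODE.

(** * The third order equation for Psi *)

Definition Psi_coef (F : numFieldType) k l (al : F) p q : F :=
  F122_coef 2^-1 k.+1%:R l.+1%:R (- k%:R) (- l%:R) (1 + al) (1 - al) p q
  * (-1) ^+ q.

Lemma Psi_double_sum (F : numFieldType) k l m n : Psi F k l m n =
  Psi_prefactor F k l m n *: double_sum k l 1 (Psi_coef k l (n%:R / m%:R)).
Proof.
congr (_ *: _); apply: eq_bigr => p _; apply: eq_bigr => q _.
rewrite /Psi_coef -scalerA; congr (_ *: _).
rewrite -mul_polyC polyC_exp polyCN polyC1 exprD -[1 - 'X]opprB.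
by rewrite [(- _) ^+ q]exprNn; ring.
Qed.

Section PsiODE.
Variables (F : numFieldType) (K : fieldType) (f : {rmorphism {poly F} -> K}).
Variables (k l : nat) (al : F).
Let x : K := f 'X.
Let a : K := f al%:P.
Hypothesis b_neq0 : forall i : nat, 1 + al + i%:R != 0.
Hypothesis c_neq0 : forall i : nat, 1 - al + i%:R != 0.
Hypothesis x0 : x != 0.
Hypothesis y0 : x - 1 != 0.
Let C := Psi_coef k l al.

Let K2 : (2 : K) != 0.
Proof. by rewrite -(rmorph_nat (f \o polyC)) fmorph_eq0 pnatr_eq0. Qed.

Let fV2 : f (2^-1)%:P = 2^-1.
Proof. by rewrite -[LHS]/((f \o polyC) _) fmorphV rmorph_nat. Qed.

Let polyCE := (polyCM, polyCB, polyCD, polyC_natr, polyC1,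
  rmorphM f, rmorphB f, rmorphD f, rmorph_nat f, rmorph1 f).
Let kk : K := k%:R.
Let ll : K := l%:R.

Let A0 := - ((kk + ll) * (kk - ll - 1) * (2 * kk - 1) * x
           - 2 * kk * ((kk + ll) * (kk - ll - 1) + a ^+ 2)).
Let A1 := 2 * kk * (2 * kk - 1) * (x - 1) ^+ 2 + 2 * (1 - a ^+ 2) * x ^+ 2
   + 2 * (kk ^+ 2 - ll ^+ 2 - 5 * kk - ll + 2 + a ^+ 2) * x * (x - 1).
Let A2 := - ((6 * kk - 3) * x * (x - 1) ^+ 2 - 6 * x ^+ 2 * (x - 1)).
Let A3 := 2 * x ^+ 2 * (x - 1) ^+ 2.

Let yE : f 'X - f 1%:P = x - 1.
Proof. by rewrite polyC1 rmorph1. Qed.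

(** The coefficients of this certificate, of degree 2 in p and q, solve the
    linear system obtained by comparing powers of p and q.  It degenerates at
    4 alpha^2 = 1: there the left-hand side vanishes identically and nothing
    is learned about the sum. *)
Lemma Psi_sum_ode_generic :
  let P := double_sum k l 1 C in
  (4 * a ^+ 2 - 1) * A0 * f P + (4 * a ^+ 2 - 1) * A1 * f P^`()
  + (4 * a ^+ 2 - 1) * A2 * f P^`(2) + (4 * a ^+ 2 - 1) * A3 * f P^`(3) = 0.
Proof.
apply: (@double_sum_ode _ _ f k l 1 C x0 _ _ _ _ _
  (fun N => N ^+ 2 - a ^+ 2) (fun N => N + 2^-1)
  (fun p q => 8 * ((x - 1) * ll * (ll + 1)
     - (4 * a ^+ 2 - 1) / (4 * (x - 1)) - (2 * x - 5) / 2 * q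
     - x * q ^+ 2 - p * q))
  (fun p q => 8 / x * ((x - 1) * kk * (kk + 1)
     - (4 * a ^+ 2 - 1) * x ^+ 2 / (4 * (x - 1)) - (5 * x - 2) / 2 * p
     + x * p * q + p ^+ 2)) 1 (-1)).
- by rewrite yE.
- by move=> q; rewrite /C /Psi_coef F122_coef_0l mul0r.
- by move=> q; rewrite /C /Psi_coef F122_coef_0r mul0r.
- move=> p q; have := F122_coef_recl k l 2^-1 b_neq0 c_neq0 p q.
  move=> /(congr1 (fun z => f z%:P)).
  rewrite /C /Psi_coef.
  move: (F122_coef _ _ _ _ _ _ _ _ _) (F122_coef _ _ _ _ _ _ _ _ _).
  move=> c1 c0; rewrite !polyCE fV2 => E.
  apply: (eq_of_multiple (f ((-1) ^+ q)%:P) E); rewrite natrD -/a.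
  by ring.
- move=> p q; have := F122_coef_recr k l 2^-1 b_neq0 c_neq0 p q.
  move=> /(congr1 (fun z => f z%:P)).
  rewrite /C /Psi_coef.
  move: (F122_coef _ _ _ _ _ _ _ _ _) (F122_coef _ _ _ _ _ _ _ _ _).
  move=> c1 c0; rewrite [(-1) ^+ q.+1]exprS !polyCE fV2 => E.
  rewrite polyCN rmorphN polyC1 rmorph1.
  apply: (eq_of_multiple (- f ((-1) ^+ q)%:P) E); rewrite natrD -/a.
  by ring.
move=> p q; rewrite /logder1 /logder2 /logder3 yE -/x /A0 /A1 /A2 /A3.
rewrite -/kk -/ll.
by field; rewrite K2 x0 y0 (natrM _ 2 2) mulf_neq0.
Qed.

(** At alpha = 1/2 the factor (1/2)_(p+q) in the numerator of the coefficients
    cancels (1 - alpha)_(p+q) in the denominator.  The shorter recurrence has a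
    certificate of degree 1. *)
Lemma Psi_sum_ode_half : al = 2^-1 ->
  let P := double_sum k l 1 C in
  A0 * f P + A1 * f P^`() + A2 * f P^`(2) + A3 * f P^`(3) = 0.
Proof.
move=> al_half.
have aE : a = 2^-1 by rewrite /a al_half fV2.
have cE N : 2^-1 + N = 1 - al + N.
  by congr (_ + _); rewrite al_half; field.
have recl p q := F122_coef_recl k l 2^-1 b_neq0 c_neq0 p q.
have recr p q := F122_coef_recr k l 2^-1 b_neq0 c_neq0 p q.
have {}recl p q : p.+1%:R * (1 + al + (p + q)%:R) * C p.+1 q
    = (p%:R + k%:R + 1) * (p%:R - k%:R) * C p q.
  apply: (mulfI (c_neq0 (p + q))); have := recl p q; rewrite cE => E.
  by apply: (eq_of_multiple ((-1) ^+ q) E); rewrite /C /Psi_coef; ring.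
have {}recr p q : q.+1%:R * (1 + al + (p + q)%:R) * C p q.+1
    = - (q%:R + l%:R + 1) * (q%:R - l%:R) * C p q.
  apply: (mulfI (c_neq0 (p + q))); have := recr p q; rewrite cE => E.
  apply: (eq_of_multiple (- (-1) ^+ q) E).
  by rewrite /C /Psi_coef [(-1) ^+ q.+1]exprS; ring.
apply: (@double_sum_ode _ _ f k l 1 C x0 _ _ _ _ _
  (fun N => N + 2^-1) (fun=> 1)
  (fun p q => - 2 / (x - 1) * (p + x * q - 1 / 2))
  (fun p q => - 2 / (x - 1) * (p + x * q - x / 2)) 1 (-1)).
- by rewrite yE.
- by move=> q; rewrite /C /Psi_coef F122_coef_0l mul0r.
- by move=> q; rewrite /C /Psi_coef F122_coef_0r mul0r.
- move=> p q; have := recl p q; move: (C _ _) (C _ _) => c1 c0.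
  move=> /(congr1 (fun z => f z%:P)); rewrite !polyCE -/a => E.
  by apply: (eq_of_multiple 1 E); rewrite aE; field; rewrite K2.
- move=> p q; have := recr p q; move: (C _ _) (C _ _) => c1 c0.
  move=> /(congr1 (fun z => f z%:P)).
  rewrite !polyCE polyCN rmorphN !polyCE -/a => E.
  by apply: (eq_of_multiple 1 E); rewrite aE; field; rewrite K2.
move=> p q; rewrite /logder1 /logder2 /logder3 yE -/x /A0 /A1 /A2 /A3.
rewrite -/kk -/ll aE.
by field; rewrite K2 x0 y0.
Qed.

Hypothesis al_ge0 : 0 <= al.

Lemma Psi_sum_ode :
  let P := double_sum k l 1 C in
  A0 * f P + A1 * f P^`() + A2 * f P^`(2) + A3 * f P^`(3) = 0.
Proof.
have [al_half|al_half] := eqVneq al 2^-1; first exact: Psi_sum_ode_half.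
have a0 : 4 * a ^+ 2 - 1 != 0.
  have -> : 4 * a ^+ 2 - 1 = f (4 * al ^+ 2 - 1)%:P.
    by rewrite polyCB rmorphB polyCM rmorphM polyC_exp rmorphXn !polyCE.
  rewrite -[f _]/((f \o polyC) _) fmorph_eq0.
  have -> : 4 * al ^+ 2 - 1 = 4 * (al + 2^-1) * (al - 2^-1).
    by field.
  by rewrite !mulf_neq0 ?subr_eq0 // ?pnatr_eq0 // gt_eqF // ltr_wpDl ?invr_gt0.
move=> P; apply: (mulfI a0); rewrite mulr0 -[RHS]Psi_sum_ode_generic -/P; ring.
Qed.
End PsiODE.

(** * The differential operators and the change of variable x = s^2 *)

Section Operators.
Variables (F : numFieldType) (k l : nat).
Implicit Types (al : F) (P Q G H z : {poly F}).

Definition dihedral_op al G : {poly F} :=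
  ((l%:R * (l%:R + 1) - k%:R * (k%:R - 1)) * 'X - 2 * al%:P * k%:R) * G
  + 2 * (al%:P * 'X - k%:R + (k%:R - 1) * 'X ^+ 2) * G^`()
  + 'X * (1 - 'X ^+ 2) * G^`(2).

Definition psi_c0 al z : {poly F} :=
  - ((k%:R + l%:R) * (k%:R - l%:R - 1) * (2 * k%:R - 1) * z
     - 2 * k%:R * ((k%:R + l%:R) * (k%:R - l%:R - 1) + al%:P ^+ 2)).
Definition psi_c1 al z : {poly F} :=
  2 * k%:R * (2 * k%:R - 1) * (z - 1) ^+ 2 + 2 * (1 - al%:P ^+ 2) * z ^+ 2
  + 2 * (k%:R ^+ 2 - l%:R ^+ 2 - 5 * k%:R - l%:R + 2 + al%:P ^+ 2)
    * z * (z - 1).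

(** The third order equation of the theorem times 2 x^2 (x - 1)^2. *)
Definition psi_op al P : {poly F} :=
  psi_c0 al 'X * P + psi_c1 al 'X * P^`()
  - ((6 * k%:R - 3) * 'X * ('X - 1) ^+ 2 - 6 * 'X ^+ 2 * ('X - 1)) * P^`(2)
  + 2 * 'X ^+ 2 * ('X - 1) ^+ 2 * P^`(3).

(** The operator psi_op in the variable s, times 4 s. *)
Definition psi_op_sqrt al Q : {poly F} :=
  4 * 'X * (psi_c0 al 'X^2) * Q
  + (6 * ('X^2 - 1) * (k%:R * ('X^2 - 1) - 'X^2) + 2 * (psi_c1 al 'X^2))
    * Q^`()
  + 6 * 'X * ('X^2 - 1) * ('X^2 - k%:R * ('X^2 - 1)) * Q^`(2)
  + 'X^2 * ('X^2 - 1) ^+ 2 * Q^`(3).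

Let compE := (comp_polyM, comp_polyB, comp_polyD, comp_polyX, comp_polyC).
Let compnat n (q : {poly F}) : n%:R \Po q = n%:R.
Proof. by rewrite -polyC_natr comp_polyC. Qed.
Let comp1 (q : {poly F}) : 1 \Po q = 1.
Proof. by rewrite -polyC1 comp_polyC. Qed.
Let compN (p q : {poly F}) : (- p) \Po q = - (p \Po q).
Proof. exact: rmorphN. Qed.
Let compX (p q : {poly F}) n : (p ^+ n) \Po q = (p \Po q) ^+ n.
Proof. exact: rmorphXn. Qed.
Let compeE := (compnat, comp1, compX, compN, compE).

Lemma deriv_comp_sqr P : (P \Po 'X^2)^`() = 2 * 'X * (P^`() \Po 'X^2).
Proof. by rewrite deriv_comp derivXn expr1; ring. Qed.

Let derE := (derivM, derivX, deriv_nat, deriv_comp_sqr).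
Lemma derivn2_comp_sqr P : (P \Po 'X^2)^`(2)
  = 2 * (P^`() \Po 'X^2) + 4 * 'X ^+ 2 * (P^`(2) \Po 'X^2).
Proof. by rewrite !derivn2 !derE; ring. Qed.

Lemma derivn3_comp_sqr P : (P \Po 'X^2)^`(3)
  = 12 * 'X * (P^`(2) \Po 'X^2) + 8 * 'X ^+ 3 * (P^`(3) \Po 'X^2).
Proof.
rewrite derivn3 derivn2_comp_sqr derivD !derE -derivn3.
by ring.
Qed.

Lemma psi_op_comp_sqr al P :
  psi_op_sqrt al (P \Po 'X^2) = 4 * 'X * (psi_op al P \Po 'X^2).
Proof.
rewrite /psi_op /psi_op_sqrt /psi_c0 /psi_c1.
rewrite deriv_comp_sqr derivn2_comp_sqr derivn3_comp_sqr !compeE.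
by ring.
Qed.

Lemma deriv_comp_opp P : (P \Po - 'X)^`() = - (P^`() \Po - 'X).
Proof. by rewrite deriv_comp derivN derivX mulrN1. Qed.

Lemma dihedral_op_opp al G :
  dihedral_op al G = 0 -> dihedral_op (- al) (G \Po - 'X) = 0.
Proof.
move=> opG; apply: oppr_inj; rewrite oppr0.
rewrite -[RHS](comp_poly0 (- 'X)) -opG /dihedral_op !derivn2.
rewrite !(deriv_comp_opp, derivN) !compeE polyCN.
by ring.
Qed.

(** The indicial polynomial of the operator at s = 1 is 4 r (r^2 - alpha^2).  A
    solution vanishing at 1 to the exact order r > 0 would make r a root. *)
Lemma psi_op_sqrt_uniq al Q : (forall i : nat, al != i%:R) ->
  (forall i : nat, al != - i%:R) ->
  psi_op_sqrt al Q = 0 -> Q.[1] = 0 -> Q = 0.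
Proof.
move=> alpha_neq_nat alpha_neq_oppn opQ Q1; apply/eqP/negPn/negP => Q_neq0.
have [[|r] [R /implyP/(_ Q_neq0) R1 defQ]] := multiplicity_XsubC Q 1.
  by move: R1; rewrite rootE; rewrite defQ expr0 mulr1 in Q1; rewrite Q1 eqxx.
pose T : {poly F} := 'X - 1.
have dT : T^`() = 1 by rewrite derivB derivX derivC subr0.
pose r1 : {poly F} := r.+1%:R.
(* Conjugating T d/ds by T^(r+1) adds r + 1 to it, so that no negative powers
   of T occur; R_1, R_2, R_3 are the iterates on R. *)
have theta (S : {poly F}) :
    T * (S * T ^+ r.+1)^`() = (r1 * S + T * S^`()) * T ^+ r.+1.
  rewrite derivM deriv_exp dT /= /r1 exprS; ring.
pose R_1 := r1 * R + T * R^`().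
pose R_2 := r1 * R_1 + T * R_1^`().
pose R_3 := r1 * R_2 + T * R_2^`().
have defQT : Q = R * T ^+ r.+1 by rewrite defQ.
have E1 : T * Q^`() = R_1 * T ^+ r.+1 by rewrite defQT theta.
have E2 : T ^+ 2 * Q^`(2) = (R_2 - R_1) * T ^+ r.+1.
  have := theta R_1; rewrite -E1 derivM dT -/R_2 => E.
  by rewrite mulrBl -E -E1; ring.
have E3 : T ^+ 3 * Q^`(3) = (R_3 - 3 * R_2 + 2 * R_1) * T ^+ r.+1.
  have := theta (R_2 - R_1); rewrite -E2 derivM -derivn3 expr2 derivM dT.
  rewrite derivB (_ : _ + T * (_ - _) = R_3 - R_2); last first.
    have dR1 : T * R_1^`() = R_2 - r1 * R_1 by rewrite /R_2; ring.
    by rewrite mulrBr mulrBr dR1 /R_3; ring.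
  suff -> : T ^+ 3 * Q^`(3) = T * ((1 * T + T * 1) * Q^`(2) + T * T * Q^`(3))
      - 2 * (T ^+ 2 * Q^`(2)) by move=> ->; rewrite E2; ring.
  by ring.
(* T times the operator applied to Q is E T^(r+1). *)
pose E := (4 * 'X * (psi_c0 al 'X^2)) * T * R
  + (6 * ('X^2 - 1) * (k%:R * ('X^2 - 1) - 'X^2) + 2 * (psi_c1 al 'X^2))
    * R_1
  + 6 * 'X * ('X + 1) * ('X^2 - k%:R * ('X^2 - 1)) * (R_2 - R_1)
  + 'X^2 * ('X + 1) ^+ 2 * (R_3 - 3 * R_2 + 2 * R_1).
have E0 : E = 0.
  apply: (mulIf (_ : T ^+ r.+1 != 0)).
    by rewrite expf_neq0 // polyXsubC_eq0.
  rewrite mul0r -(mulr0 T) -opQ /psi_op_sqrt /E.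
  move: (psi_c0 _ _) (psi_c1 _ _) => c0 c1.
  transitivity (4 * 'X * c0 * T * Q
     + (6 * ('X^2 - 1) * (k%:R * ('X^2 - 1) - 'X^2) + 2 * c1) * (T * Q^`())
     + 6 * 'X * ('X + 1) * ('X^2 - k%:R * ('X^2 - 1)) * (T ^+ 2 * Q^`(2))
     + 'X^2 * ('X + 1) ^+ 2 * (T ^+ 3 * Q^`(3))).
    by rewrite E1 E2 E3 defQT; ring.
  by rewrite /T; ring.
have hn n : (n%:R : {poly F}).[1] = n%:R by rewrite -polyC_natr hornerC.
have T1 : T.[1] = 0 by rewrite !hornerE subrr.
have R_1E : R_1.[1] = r.+1%:R * R.[1].
  by rewrite /R_1 hornerD !hornerM T1 mul0r addr0 hn.
have R_2E : R_2.[1] = r.+1%:R * R_1.[1].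
  by rewrite /R_2 hornerD !hornerM T1 mul0r addr0 hn.
have R_3E : R_3.[1] = r.+1%:R * R_2.[1].
  by rewrite /R_3 hornerD !hornerM T1 mul0r addr0 hn.
have c1_at1 : (psi_c1 al 'X^2).[1] = 2 * (1 - al ^+ 2).
  rewrite /psi_c1 !(hornerM, hornerD, hornerN, hornerXn, hornerX, hornerC, hn,
    horner_exp).
  by ring.
have : E.[1] = 4 * r.+1%:R * (r.+1%:R ^+ 2 - al ^+ 2) * R.[1].
  rewrite /E.
  rewrite !(hornerM, hornerD, hornerN, hornerXn, hornerX, hornerC, hn,
    horner_exp, c1_at1, R_3E, R_2E, R_1E, T1).
  by ring.
rewrite E0 horner0 => /esym/eqP; rewrite !mulf_eq0 subr_eq0 !pnatr_eq0 /=.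
rewrite [R.[1] == 0](negPf R1) orbF eqf_sqr => /orP[/eqP eq_al|/eqP eq_al].
  by have := alpha_neq_nat r.+1; rewrite eq_al eqxx.
by have := alpha_neq_oppn r.+1; rewrite eq_al opprK eqxx.
Qed.
End Operators.

(** * The product of two solutions *)

(** The symmetric square: eliminating second and third derivatives by means of
    the two equations and their derivatives leaves an identity in the
    functions g0, h0 and their first derivatives g1, h1. *)
Lemma dihedral_product_alg (K : fieldType)
    (x a kk ll g0 g1 g2 g3 h0 h1 h2 h3 : K) :
  let c := ll * (ll + 1) - kk * (kk - 1) in
  x != 0 -> x ^+ 2 - 1 != 0 ->
  (c * x - 2 * a * kk) * g0 + 2 * (a * x - kk + (kk - 1) * x ^+ 2) * g1
    + x * (1 - x ^+ 2) * g2 = 0 ->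
  (c * x - 2 * a * kk) * g1 + c * g0
    + 2 * (a * x - kk + (kk - 1) * x ^+ 2) * g2
    + 2 * (a + 2 * (kk - 1) * x) * g1
    + x * (1 - x ^+ 2) * g3 + (1 - 3 * x ^+ 2) * g2 = 0 ->
  (c * x - 2 * (- a) * kk) * h0 + 2 * ((- a) * x - kk + (kk - 1) * x ^+ 2) * h1
    + x * (1 - x ^+ 2) * h2 = 0 ->
  (c * x - 2 * (- a) * kk) * h1 + c * h0
    + 2 * ((- a) * x - kk + (kk - 1) * x ^+ 2) * h2
    + 2 * ((- a) + 2 * (kk - 1) * x) * h1
    + x * (1 - x ^+ 2) * h3 + (1 - 3 * x ^+ 2) * h2 = 0 ->
  let X := x ^+ 2 in
  let c0 := - ((kk + ll) * (kk - ll - 1) * (2 * kk - 1) * X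
     - 2 * kk * ((kk + ll) * (kk - ll - 1) + a ^+ 2)) in
  let c1 := 2 * kk * (2 * kk - 1) * (X - 1) ^+ 2 + 2 * (1 - a ^+ 2) * X ^+ 2
    + 2 * (kk ^+ 2 - ll ^+ 2 - 5 * kk - ll + 2 + a ^+ 2) * X * (X - 1) in
  4 * x * c0 * (g0 * h0)
  + (6 * (X - 1) * (kk * (X - 1) - X) + 2 * c1) * (g1 * h0 + g0 * h1)
  + 6 * x * (X - 1) * (X - kk * (X - 1)) * (g2 * h0 + 2 * g1 * h1 + g0 * h2)
  + X * (X - 1) ^+ 2 * (g3 * h0 + 3 * g2 * h1 + 3 * g1 * h2 + g0 * h3) = 0.
Proof.
move=> c x0 x1 EG EG' EH EH'.
have w0 : x * (x ^+ 2 - 1) != 0 by rewrite mulf_neq0.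
have g2E : g2 = ((c * x - 2 * a * kk) * g0
    + 2 * (a * x - kk + (kk - 1) * x ^+ 2) * g1) / (x * (x ^+ 2 - 1)).
  by apply: (mulfI w0); apply: (eq_of_multiple (-1) EG); field; rewrite x0 x1.
have h2E : h2 = ((c * x - 2 * (- a) * kk) * h0
    + 2 * ((- a) * x - kk + (kk - 1) * x ^+ 2) * h1) / (x * (x ^+ 2 - 1)).
  by apply: (mulfI w0); apply: (eq_of_multiple (-1) EH); field; rewrite x0 x1.
have g3E : g3 = ((c * x - 2 * a * kk) * g1 + c * g0
    + 2 * (a * x - kk + (kk - 1) * x ^+ 2) * g2
    + 2 * (a + 2 * (kk - 1) * x) * g1 + (1 - 3 * x ^+ 2) * g2)
    / (x * (x ^+ 2 - 1)).
  by apply: (mulfI w0); apply: (eq_of_multiple (-1) EG'); field; rewrite x0 x1.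
have h3E : h3 = ((c * x - 2 * (- a) * kk) * h1 + c * h0
    + 2 * ((- a) * x - kk + (kk - 1) * x ^+ 2) * h2
    + 2 * ((- a) + 2 * (kk - 1) * x) * h1 + (1 - 3 * x ^+ 2) * h2)
    / (x * (x ^+ 2 - 1)).
  by apply: (mulfI w0); apply: (eq_of_multiple (-1) EH'); field; rewrite x0 x1.
rewrite g3E h3E g2E h2E /c /=.
by field; rewrite x0 x1.
Qed.

Lemma derivn2M (R : comNzRingType) (P Q : {poly R}) :
  (P * Q)^`(2) = P^`(2) * Q + 2 * P^`() * Q^`() + P * Q^`(2).
Proof. by rewrite !derivn2 !(derivM, derivD); ring. Qed.

Lemma derivn3M (R : comNzRingType) (P Q : {poly R}) : (P * Q)^`(3) =
  P^`(3) * Q + 3 * P^`(2) * Q^`() + 3 * P^`() * Q^`(2) + P * Q^`(3).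
Proof. by rewrite !derivn3 !derivn2 !(derivM, derivD); ring. Qed.

Section DihedralProduct.
Variables (F : numFieldType) (K : fieldType) (f : {rmorphism {poly F} -> K}).
Hypothesis f_inj : injective f.
Variables (k l : nat).

Let f_neq0 p : p != 0 -> f p != 0.
Proof. by move=> p0; rewrite -(rmorph0 f) (inj_eq f_inj). Qed.

Let fE := (rmorph_nat f, rmorph1 f, rmorphXn f, rmorphN f, rmorphM f,
  rmorphB f, rmorphD f).

Lemma sqrX_sub1_neq0 : ('X^2 - 1 : {poly F}) != 0.
Proof. by rewrite -size_poly_gt0 size_XnsubC. Qed.

Lemma dihedral_op_deriv al (G : {poly F}) : (dihedral_op k l al G)^`() =
  ((l%:R * (l%:R + 1) - k%:R * (k%:R - 1)) * 'X - 2 * al%:P * k%:R) * G^`()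
  + (l%:R * (l%:R + 1) - k%:R * (k%:R - 1)) * G
  + 2 * (al%:P * 'X - k%:R + (k%:R - 1) * 'X ^+ 2) * G^`(2)
  + 2 * (al%:P + 2 * (k%:R - 1) * 'X) * G^`()
  + 'X * (1 - 'X ^+ 2) * G^`(3) + (1 - 3 * 'X ^+ 2) * G^`(2).
Proof.
rewrite /dihedral_op expr2 !(derivB, derivD, derivM, derivX, deriv_nat, derivC).
by rewrite -derivn3 -derivn2; ring.
Qed.

Lemma dihedral_product al (G H : {poly F}) :
  dihedral_op k l al G = 0 -> dihedral_op k l (- al) H = 0 ->
  psi_op_sqrt k l al (G * H) = 0.
Proof.
move=> opG opH; apply: f_inj.
have dG := dihedral_op_deriv al G; rewrite opG deriv0 in dG.
have dH := dihedral_op_deriv (- al) H; rewrite opH deriv0 in dH.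
have x0 : f 'X != 0 by rewrite f_neq0 ?polyX_eq0.
have x1 : f 'X ^+ 2 - 1 != 0.
  by rewrite -rmorphXn -(rmorph1 f) -rmorphB f_neq0 ?sqrX_sub1_neq0.
have := dihedral_product_alg (K := K) (x := f 'X) (a := f al%:P) (kk := k%:R)
  (ll := l%:R) (g0 := f G) (g1 := f G^`()) (g2 := f G^`(2)) (g3 := f G^`(3))
  (h0 := f H) (h1 := f H^`()) (h2 := f H^`(2)) (h3 := f H^`(3)) x0 x1.
move: opG opH dG dH; rewrite /dihedral_op polyCN.
move=> /(congr1 f) eG /(congr1 f) eH /(congr1 f) edG /(congr1 f) edH.
rewrite rmorph0 !fE in eG; rewrite rmorph0 !fE in eH.
rewrite rmorph0 !fE in edG; rewrite rmorph0 !fE in edH.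
move=> /(_ eG (esym edG)) alg.
have {}alg := alg eH (esym edH).
rewrite rmorph0 /psi_op_sqrt /psi_c0 /psi_c1 derivn3M derivn2M derivM !fE.
by apply: (eq_of_multiple 1 alg); ring.
Qed.
End DihedralProduct.

(** * The equation for Theta_2 *)

(** The left-hand side of the third relation times 4 x (x - 1) Y T. *)
Definition theta_form (R : comNzRingType) (kk ll mm nn x Y Y1 Y2 T T1 T2 : R) :=
  4 * x * (x - 1) * Y * T2
  + ((4 * kk + 6) * (x - 1) * Y - 4 * (nn - 1) * x * Y
     - 4 * (mm - 1) * x * (x - 1) * Y1) * T1
  + (2 * mm * (mm - 1) * x * (x - 1) * Y2
     - (mm - 1) * ((mm * (2 * kk - 1) + 4 * kk + 2) * (x - 1)
                   - 2 * (mm + nn) * x) * Y1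
     + (mm ^+ 2 * (kk + ll) * (kk - ll - 1) + (nn - 2) * (nn - 2 * kk - 1)) * Y)
    * T.

(** theta_form in terms of derivatives with respect to s of y = Y(s^2) and of
    v, where v is T(s^2) times s^(2k+1): u1 and u2 are s^(2k+1) times the
    first two derivatives of v / s^(2k+1). *)
Definition sqrt_theta_form (K : fieldType)
    (kk ll mm nn s y0 y1 y2 v0 v1 v2 : K) :=
  let u1 := v1 - (2 * kk + 1) * v0 / s in
  let u2 := v2 - 2 * (2 * kk + 1) * v1 / s
              + (2 * kk + 1) * (2 * kk + 2) * v0 / s ^+ 2 in
  theta_form kk ll mm nn (s ^+ 2)
    y0 (y1 / (2 * s)) ((y2 - y1 / s) / (4 * s ^+ 2))
    v0 (u1 / (2 * s)) ((u2 - u1 / s) / (4 * s ^+ 2)).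

(** For y = (1 + e s)^(n/m) g the equation y'' = A y' + B y implies that v = y^m
    is a solution of v'' + a v' + b v = 0, where r_1, r_2 denote the
    logarithmic derivatives of the two solutions, as soon as
    a = - A - (m - 1) (r_1 + r_2) and b = m (m - 1) r_1 r_2 - m B.  This is
    symmetric in r_1 and r_2, so both signs e lead to one equation. *)
Lemma dihedral_power_alg (K : fieldType)
    (e s kk ll mm nn g0 g1 g2 h0 h1 h2 v0 v1 v2 : K) :
  let c := ll * (ll + 1) - kk * (kk - 1) in
  let a := e * nn / mm in
  e = 1 \/ e = -1 ->
  (2 : K) != 0 -> mm != 0 -> s != 0 -> 1 + s != 0 -> 1 - s != 0 -> g0 != 0 ->
  (c * s - 2 * a * kk) * g0 + 2 * (a * s - kk + (kk - 1) * s ^+ 2) * g1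
    + s * (1 - s ^+ 2) * g2 = 0 ->
  (c * s - 2 * (- a) * kk) * h0 + 2 * ((- a) * s - kk + (kk - 1) * s ^+ 2) * h1
    + s * (1 - s ^+ 2) * h2 = 0 ->
  (1 + e * s) * g0 * v1 = (e * nn * g0 + mm * (1 + e * s) * g1) * v0 ->
  (e * g0 + (1 + e * s) * g1) * v1 + (1 + e * s) * g0 * v2
  = (e * nn * g1 + mm * e * g1 + mm * (1 + e * s) * g2) * v0
    + (e * nn * g0 + mm * (1 + e * s) * g1) * v1 ->
  sqrt_theta_form kk ll mm nn s (g0 * h0) (g1 * h0 + g0 * h1)
    (g2 * h0 + 2 * g1 * h1 + g0 * h2) v0 v1 v2 = 0.
Proof.
move=> c a e1 K2 m0 s0 sp sm g00 EG EH EV EV'.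
have K4 : (4 : K) != 0 by rewrite (natrM _ 2 2) mulf_neq0.
have w0 : s * (1 - s ^+ 2) != 0.
  by rewrite mulf_neq0 // (_ : _ - _ = (1 + s) * (1 - s)) ?mulf_neq0 //; ring.
have ge : (1 + e * s) * g0 != 0.
  by apply: mulf_neq0 => //; case: e1 => ->; rewrite ?mul1r ?mulN1r.
have g2E : g2 = - ((c * s - 2 * a * kk) * g0
    + 2 * (a * s - kk + (kk - 1) * s ^+ 2) * g1) / (s * (1 - s ^+ 2)).
  by apply: (canRL (mulfK w0)); apply: (eq_of_multiple 1 EG); ring.
have h2E : h2 = - ((c * s - 2 * (- a) * kk) * h0
    + 2 * ((- a) * s - kk + (kk - 1) * s ^+ 2) * h1) / (s * (1 - s ^+ 2)).
  by apply: (canRL (mulfK w0)); apply: (eq_of_multiple 1 EH); ring.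
have v1E : v1 = (e * nn * g0 + mm * (1 + e * s) * g1) * v0 / ((1 + e * s) * g0).
  by apply: (canRL (mulfK ge)); rewrite mulrC.
have v2E : v2 = ((e * nn * g1 + mm * e * g1 + mm * (1 + e * s) * g2) * v0
    + (e * nn * g0 + mm * (1 + e * s) * g1) * v1
    - (e * g0 + (1 + e * s) * g1) * v1) / ((1 + e * s) * g0).
  by apply: (canRL (mulfK ge)); apply: (eq_of_multiple 1 EV'); ring.
rewrite /sqrt_theta_form /theta_form v2E v1E g2E h2E /a /c.
have sq : 1 - s ^+ 2 != 0 by move: w0; rewrite mulf_eq0 => /norP[].
by case: e1 => ->; field; rewrite s0 K2 K4 sq m0 g00 ?mulN1r ?sp ?sm.
Qed.

Lemma deriv_mul_exp (R : comNzRingType) (L G : {poly R}) n m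
    (V := L ^+ n * G ^+ m) :
  L * G * V^`() = (n%:R * L^`() * G + m%:R * L * G^`()) * V.
Proof.
rewrite /V derivM !deriv_exp; clear V.
by case: n m => [|n] [|m] /=; rewrite ?mulr0n ?expr0 ?exprS; ring.
Qed.

Lemma rmorph_theta_form (R S : comNzRingType) (f : {rmorphism R -> S})
    kk ll mm nn x Y Y1 Y2 T T1 T2 :
  f (theta_form kk ll mm nn x Y Y1 Y2 T T1 T2) =
  theta_form (f kk) (f ll) (f mm) (f nn) (f x) (f Y) (f Y1) (f Y2)
    (f T) (f T1) (f T2).
Proof.
by rewrite /theta_form !(rmorph_nat f, rmorph1 f, rmorphXn f, rmorphM f,
  rmorphB f, rmorphD f).
Qed.

Lemma sqrt_theta_formB (K : fieldType) (kk ll mm nn s y0 y1 y2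
    v0 v1 v2 w0 w1 w2 : K) :
  sqrt_theta_form kk ll mm nn s y0 y1 y2 (v0 - w0) (v1 - w1) (v2 - w2) =
  sqrt_theta_form kk ll mm nn s y0 y1 y2 v0 v1 v2
  - sqrt_theta_form kk ll mm nn s y0 y1 y2 w0 w1 w2.
Proof. by rewrite /sqrt_theta_form /theta_form; ring. Qed.

(** The arguments are c Y(s^2), 2 W T(s^2) and their derivatives in s when
    W = s^(2k+1), whose derivatives have been replaced by multiples of W. *)
Lemma sqrt_theta_formE (K : fieldType) (kk ll mm nn s c W Y Y1 Y2 T T1 T2 : K) :
  (2 : K) != 0 -> s != 0 ->
  sqrt_theta_form kk ll mm nn s (c * Y) (c * (2 * s * Y1))
    (c * (2 * Y1 + 4 * s ^+ 2 * Y2))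
    (2 * W * T) (2 * W * (2 * s * T1) + 2 * ((2 * kk + 1) * W / s) * T)
    (2 * W * (2 * T1 + 4 * s ^+ 2 * T2)
     + 4 * ((2 * kk + 1) * W / s) * (2 * s * T1)
     + 2 * ((2 * kk + 1) * (2 * kk) * W / s ^+ 2) * T)
  = 2 * c * W * theta_form kk ll mm nn (s ^+ 2) Y Y1 Y2 T T1 T2.
Proof.
move=> K2 s0; have K4 : (4 : K) != 0 by rewrite (natrM _ 2 2) mulf_neq0.
by rewrite /sqrt_theta_form /theta_form; field; rewrite s0 K2 K4.
Qed.

Section ThetaOde.
Variables (F : numFieldType) (K : fieldType) (f : {rmorphism {poly F} -> K}).
Hypothesis f_inj : injective f.
Variables (k l m n : nat).
Hypothesis m_gt0 : (0 < m)%N.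

Let f_neq0 p : p != 0 -> f p != 0.
Proof. by move=> p0; rewrite -(rmorph0 f) (inj_eq f_inj). Qed.

Let fE := (rmorph_nat f, rmorph1 f, rmorphXn f, rmorphN f, rmorphM f,
  rmorphB f, rmorphD f).

Let natK i : (i.+1%:R : K) != 0.
Proof. by rewrite -(rmorph_nat (f \o polyC)) fmorph_eq0 pnatr_eq0. Qed.

Let sqrt_form Q V := sqrt_theta_form k%:R l%:R m%:R n%:R (f 'X)
  (f Q) (f Q^`()) (f Q^`(2)) (f V) (f V^`()) (f V^`(2)).

Lemma dihedral_power (e : F) (G H : {poly F}) :
  e = 1 \/ e = -1 -> G != 0 ->
  dihedral_op k l (e * n%:R / m%:R) G = 0 ->
  dihedral_op k l (- (e * n%:R / m%:R)) H = 0 ->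
  sqrt_form (G * H) ((1 + e%:P * 'X) ^+ n * G ^+ m) = 0.
Proof.
move=> e1 G0 opG opH.
pose a : K := f (e * n%:R / m%:R)%:P.
have m0 : (m%:R : K) != 0 by case: (m) m_gt0.
have fe1 : f e%:P = 1 \/ f e%:P = -1.
  by case: e1 => ->; [left|right]; rewrite ?polyCN !fE.
have aE : a = f e%:P * n%:R / m%:R.
  by rewrite /a -[LHS]/((f \o polyC) _) fmorph_div rmorphM !rmorph_nat.
pose L : {poly F} := 1 + e%:P * 'X.
have dL : L^`() = e%:P.
  by rewrite /L derivD derivM derivX -polyC1 !derivC; ring.
have EV := deriv_mul_exp L G n m; rewrite dL in EV.
rewrite /sqrt_form -/L; move: EV; move: (L ^+ n * _) => V EV.
have EV' := congr1 (@deriv F) EV.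
rewrite !(derivM, derivD, derivC, deriv_nat, dL) in EV'.
have x0 : f 'X != 0 by rewrite f_neq0 ?polyX_eq0.
have xp : 1 + f 'X != 0.
  rewrite -(rmorph1 f) -rmorphD f_neq0 // addrC -polyC1 -size_poly_eq0.
  by rewrite size_XaddC.
have xm : 1 - f 'X != 0.
  rewrite -(rmorph1 f) -rmorphB f_neq0 // subr_eq0 eq_sym -subr_eq0 -polyC1.
  by rewrite polyXsubC_eq0.
rewrite derivn2M derivM !fE.
apply: (dihedral_power_alg fe1 (natK 1) m0 x0 xp xm (f_neq0 G0)).
- by move/(congr1 f): opG; rewrite /dihedral_op rmorph0 !fE -/a aE.
- by move/(congr1 f): opH; rewrite /dihedral_op rmorph0 polyCN !fE -/a aE.
- by move/(congr1 f): EV; rewrite !fE => E; apply: (eq_of_multiple 1 E); ring.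
move/(congr1 f): EV'; rewrite -!derivn2 !fE rmorph0 => E.
by apply: (eq_of_multiple 1 E); ring.
Qed.

Lemma theta_form_eq0 (c : F) (G H P T : {poly F}) (al := n%:R / m%:R) :
  c != 0 -> G != 0 -> H != 0 ->
  dihedral_op k l al G = 0 -> dihedral_op k l (- al) H = 0 ->
  G * H = c%:P * (P \Po 'X^2) ->
  (1 + 'X) ^+ n * G ^+ m - (1 - 'X) ^+ n * H ^+ m
  = 2 * 'X ^+ (2 * k + 1) * (T \Po 'X^2) ->
  theta_form k%:R l%:R m%:R n%:R 'X P P^`() P^`(2) T T^`() T^`(2) = 0.
Proof.
move=> c0 G0 H0 opG opH GH VT.
have solG : sqrt_form (G * H) ((1 + 'X) ^+ n * G ^+ m) = 0.
  have := @dihedral_power 1 G H (or_introl erefl) G0.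
  by rewrite polyC1 !mul1r; apply.
have solH : sqrt_form (G * H) ((1 - 'X) ^+ n * H ^+ m) = 0.
  have := @dihedral_power (-1) H G (or_intror erefl) H0.
  rewrite !mulN1r mulNr opprK polyCN polyC1 mulN1r [H * G]mulrC.
  by apply.
have sol : sqrt_form (G * H)
    ((1 + 'X) ^+ n * G ^+ m - (1 - 'X) ^+ n * H ^+ m) = 0.
  rewrite /sqrt_form derivB derivnB !rmorphB sqrt_theta_formB.
  by move: solG solH; rewrite /sqrt_form => -> ->; rewrite subr0.
have x0 : f 'X != 0 by rewrite f_neq0 ?polyX_eq0.
pose W : {poly F} := 'X ^+ (2 * k + 1).
have dW : 'X * W^`() = (2 * k%:R + 1) * W.
  by rewrite /W derivXn addn1 /= exprS -mulr_natl -natr1 natrM; ring.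
have d2W : 'X ^+ 2 * W^`(2) = (2 * k%:R + 1) * (2 * k%:R) * W.
  have := congr1 (fun p => 'X * p^`()) dW.
  rewrite !(derivM, derivD, derivX, deriv_nat, deriv1) -derivn2 => E.
  transitivity (2 * k%:R * ('X * W^`())); last by rewrite dW; ring.
  by apply: (eq_of_multiple 1 E); ring.
rewrite -/W -mulrA -(polyC_natr F 2) in VT.
have W0 : W != 0 by rewrite expf_neq0 ?polyX_eq0.
clearbody W; pose w : K := f W.
have w1 : f W^`() = (2 * k%:R + 1) * w / f 'X.
  by apply: (canRL (mulfK x0)); rewrite mulrC -rmorphM dW !fE.
have w2 : f W^`(2) = (2 * k%:R + 1) * (2 * k%:R) * w / f 'X ^+ 2.
  apply: (canRL (mulfK (expf_neq0 2 x0))).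
  by rewrite mulrC -rmorphXn -rmorphM d2W !fE.
move: sol; rewrite VT GH /sqrt_form.
have dC i (a : F) Q : (a%:P * Q)^`(i) = a%:P * Q^`(i).
  by rewrite !mul_polyC derivnZ.
have f2 : f (2%:R : F)%:P = 2 by rewrite polyC_natr rmorph_nat.
rewrite -!derivn1 !dC !derivn1 derivn2M derivM.
rewrite !derivn2_comp_sqr !deriv_comp_sqr.
move=> sol.
have := sqrt_theta_formE k%:R l%:R m%:R n%:R (f c%:P) w
  (f (P \Po 'X^2)) (f (P^`() \Po 'X^2)) (f (P^`(2) \Po 'X^2))
  (f (T \Po 'X^2)) (f (T^`() \Po 'X^2)) (f (T^`(2) \Po 'X^2)) (natK 1) x0.
rewrite (_ : sqrt_theta_form _ _ _ _ _ _ _ _ _ _ _ = 0); last first.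
  rewrite -[RHS]sol !fE f2 w1 w2 -/w.
  by congr (sqrt_theta_form _ _ _ _ _ _ _ _ _ _ _); field.
move/esym/eqP; rewrite !mulf_eq0 (negPf (natK 1)) (negPf (f_neq0 W0)).
rewrite (negPf (f_neq0 _)) ?polyC_eq0 //= => /eqP form0.
apply/eqP; rewrite -(comp_poly_eq0 _ (q := 'X^2)) ?size_polyXn //.
rewrite -(inj_eq f_inj) rmorph0 -[_ \Po _]/(comp_poly 'X^2 _).
apply/eqP; rewrite !rmorph_theta_form !rmorph_nat /= comp_polyX.
by rewrite rmorphXn.
Qed.
End ThetaOde.

(** * The first integral *)

Lemma euler_homogeneous (F : numFieldType) d (E : {poly F}) :
  'X * E^`() = d%:R * E -> E = E.[1] *: 'X^d.
Proof.
move=> eulerE.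
have coefE i : i != d -> E`_i = 0.
  move=> i_neq_d; have /(congr1 (fun p : {poly F} => p`_i)) := eulerE.
  rewrite coefXM mulr_natl coefMn coef_deriv => Ei.
  have {}Ei : E`_i *+ i = E`_i *+ d.
    case: i i_neq_d Ei => [|j] i_neq_d /= Ei; last exact: Ei.
    by rewrite -Ei mulr0n.
  clear eulerE; move/eqP: Ei.
  rewrite -subr_eq0 -[_ *+ i]mulr_natr -[_ *+ d]mulr_natr -mulrBr mulf_eq0.
  by rewrite subr_eq0 eqr_nat (negPf i_neq_d) orbF => /eqP.
have EX : E = E`_d *: 'X^d.
  apply/polyP=> i; rewrite coefZ coefXn.
  by case: eqP => [->|/eqP/coefE ->]; rewrite ?mulr1 ?mulr0.
by rewrite {1 2}EX hornerZ hornerXn expr1n mulr1.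
Qed.

(** If E denotes the left-hand side, x E' - 2 k E is -P times the third order
    operator applied to P, so that E is homogeneous of degree 2 k. *)
Lemma psi_first_integral (F : numFieldType) k l (al : F) (P : {poly F}) :
  psi_op k l al P = 0 ->
  'X * ('X - 1) ^+ 2 * (P^`() ^+ 2 - 2 * P^`(2) * P)
  + ((2 * k%:R - 3) * 'X - 2 * k%:R + 1) * ('X - 1) * P^`() * P
  - ((k%:R + l%:R) * (k%:R - l%:R - 1) * ('X - 1) - al%:P ^+ 2) * P ^+ 2
  = (al ^+ 2 * P.[1] ^+ 2) *: 'X^(2 * k).
Proof.
move=> opP; set E := LHS.
have E1 : E.[1] = al ^+ 2 * P.[1] ^+ 2.
  rewrite /E !(hornerD, hornerN, hornerM, horner_exp, hornerX, hornerC) subrr.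
  by ring.
rewrite -E1; apply: euler_homogeneous.
apply: (eq_of_multiple (- P) opP).
rewrite natrM /E /psi_op /psi_c0 /psi_c1 !expr2.
rewrite !(derivD, derivN, derivM, derivX, derivC, deriv_nat, deriv1).
by rewrite -derivn3 -derivn2; ring.
Qed.

(** * The polynomials G, Psi and Theta_2 *)

Section Facts.
Variables (F : numFieldType) (k l m n : nat).
Hypotheses (n_gt0 : (0 < n)%N) (m_gt1 : (1 < m)%N) (co_nm : gcdn n m = 1%N).
Let al : F := n%:R / m%:R.
Local Notation G := (Gpoly F k l m n).
Local Notation H := (G \Po - 'X).
Local Notation Psi := (Psi F k l m n).

Let m_gt0 : (0 < m)%N. Proof. exact: ltnW. Qed.
Let m0 : (m%:R : F) != 0. Proof. by rewrite pnatr_eq0 -lt0n. Qed.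

Lemma m_notdvd_n : ~~ (m %| n)%N.
Proof.
apply/negP => /gcdn_idPr; rewrite co_nm => m1.
by have := m_gt1; rewrite -m1.
Qed.

Lemma alpha_neq_nat i : al != i%:R.
Proof.
apply/negP => /eqP al_i; have : n%:R = (i * m)%:R :> F.
  by rewrite natrM -al_i /al divfK.
move/eqP; rewrite eqr_nat => /eqP n_im.
by have := m_notdvd_n; rewrite n_im dvdn_mull.
Qed.

Lemma alpha_gt0 : 0 < al.
Proof. by rewrite divr_gt0 ?ltr0n. Qed.

Lemma alpha_neq_oppn i : al != - i%:R.
Proof.
by rewrite -subr_eq0 opprK gt_eqF // ltr_wpDr ?ler0n ?alpha_gt0.
Qed.

Lemma b_neq0 i : 1 + al + i%:R != 0.
Proof.
by rewrite -addrA addrCA nat1r -[i.+1%:R]opprK subr_eq0 alpha_neq_oppn.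
Qed.

Lemma c_neq0 i : 1 - al + i%:R != 0.
Proof. by rewrite addrAC nat1r subr_eq0 eq_sym alpha_neq_nat. Qed.

(** A zero of one of these Pochhammer symbols would make n / m an integer. *)
Lemma prefactor_shift_neq0 (d : F) i : d = k%:R \/ d = - k%:R ->
  (1 + d - l%:R) / 2 - n%:R / (2 * m%:R) + i%:R != 0.
Proof.
move=> dE; apply/negP => /eqP E.
have two0 : (2 : F) != 0 by rewrite pnatr_eq0.
have {}E : n%:R + (l%:R - d) * m%:R = (1 + i%:R *+ 2) * m%:R.
  apply: (eq_of_multiple (- (2 * m%:R)) E).
  by field; rewrite m0.
have dvd a b : n%:R + a%:R * m%:R = b%:R * m%:R :> F -> False.
  rewrite -!natrM -natrD => /eqP; rewrite eqr_nat => /eqP nab.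
  have := m_notdvd_n; rewrite -(dvdn_addl _ (dvdn_mull a (dvdnn m))) nab.
  by rewrite dvdn_mull.
case: dE E => -> E.
  apply: (dvd l (1 + i * 2 + k)%N).
  by apply: (eq_of_multiple 1 E); rewrite !natrD natrM; ring.
apply: (dvd (l + k)%N (1 + i * 2)%N).
by apply: (eq_of_multiple 1 E); rewrite !natrD natrM; ring.
Qed.

Lemma Psi_prefactor_neq0 : Psi_prefactor F k l m n != 0.
Proof.
rewrite /Psi_prefactor mulf_neq0 ?invr_eq0 ?mulf_neq0 ?expf_neq0 ?pnatr_eq0
  ?oppr_eq0 ?oner_eq0 //; apply: pochhammer_neq0 => i.
- exact: b_neq0.
- exact: c_neq0.
- by apply: prefactor_shift_neq0; right.
by apply: prefactor_shift_neq0; left.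
Qed.

Lemma pochhammer0 (x : F) : pochhammer x 0 = 1.
Proof. exact: big_ord0. Qed.

(** Only the term p = q = 0 survives at the point c. *)
Lemma double_sum_at (c : F) C : (double_sum k l c C).[c] = C 0 0 * c ^+ k.
Proof.
have term p q : ('X ^+ (k - p) * ('X - c%:P) ^+ (p + q)).[c]
    = c ^+ (k - p) * (p + q == 0)%N%:R.
  rewrite !(hornerM, horner_exp, hornerX, hornerD, hornerN, hornerC) subrr.
  by rewrite expr0n.
rewrite horner_sum (bigD1 ord0) //= [X in _ + X]big1 ?addr0 => [|p p0].
  rewrite horner_sum (bigD1 ord0) //= [X in _ + X]big1 ?addr0 => [|q q0].
    by rewrite hornerZ term mulr1 subn0.
  by rewrite -val_eqE in q0; rewrite hornerZ term add0n (negPf q0) !mulr0.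
rewrite horner_sum big1 // => q _.
by rewrite -val_eqE in p0; rewrite hornerZ term addn_eq0 (negPf p0) !mulr0.
Qed.

Lemma Psi_at1 : Psi.[1] = Psi_prefactor F k l m n.
Proof.
rewrite Psi_double_sum hornerZ double_sum_at expr1n mulr1.
rewrite /Psi_coef /F122_coef addn0 !pochhammer0 fact0 expr0.
by rewrite !(mulr1, invr1).
Qed.

Lemma G_atN1 : G.[-1] = (-1) ^+ k.
Proof.
rewrite Gpoly_double_sum double_sum_at.
rewrite /G_coef /F3_coef addn0 !pochhammer0 fact0 expr0.
by rewrite !(mulr1, invr1) mul1r.
Qed.

Section Frac.
Variables (K : fieldType) (f : {rmorphism {poly F} -> K}).
Hypothesis f_inj : injective f.

Let f_neq0 p : p != 0 -> f p != 0.
Proof. by move=> p0; rewrite -(rmorph0 f) (inj_eq f_inj). Qed.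

Let fE := (rmorph_nat f, rmorph1 f, rmorphXn f, rmorphN f, rmorphM f,
  rmorphB f, rmorphD f).
Let x0 : f 'X != 0. Proof. by rewrite f_neq0 ?polyX_eq0. Qed.
Let x1 : f 'X - 1 != 0.
Proof. by rewrite -(rmorph1 f) -rmorphB f_neq0 // -polyC1 polyXsubC_eq0. Qed.
Let xp : f 'X + 1 != 0.
Proof.
rewrite -(rmorph1 f) -rmorphD f_neq0 // -polyC1 -size_poly_eq0.
by rewrite size_XaddC.
Qed.

Lemma Gpoly_ode : dihedral_op k l al G = 0.
Proof.
apply: f_inj; rewrite rmorph0 Gpoly_double_sum /dihedral_op.
have := G_sum_ode k l b_neq0 x0 xp; rewrite /= -/al => <-.
by move: (double_sum _ _ _ _) => P; rewrite !fE.
Qed.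

Lemma Psi_ode : psi_op k l al Psi = 0.
Proof.
apply: f_inj; rewrite rmorph0 Psi_double_sum -/al.
have E := Psi_sum_ode k l b_neq0 c_neq0 x0 x1 (ltW alpha_gt0).
rewrite -mul_polyC -[RHS](mulr0 (f (Psi_prefactor F k l m n)%:P)).
rewrite /= in E; move: E; rewrite /Psi_coef.
move: (Psi_prefactor _ _ _ _ _) (double_sum _ _ _ _) => c P <-.
rewrite /psi_op /psi_c0 /psi_c1 !mul_polyC derivZ !derivnZ -!mul_polyC !fE.
ring.
Qed.

Lemma G_neq0 : G != 0.
Proof.
apply/eqP => G0; have := G_atN1; rewrite G0 horner0 => /esym/eqP.
by rewrite signr_eq0.
Qed.

Lemma H_neq0 : H != 0.
Proof. by rewrite comp_poly2_eq0 ?G_neq0 // size_polyN size_polyX. Qed.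

Lemma psi_op_sqrtB c (P Q : {poly F}) : psi_op_sqrt k l al (P - c%:P * Q)
  = psi_op_sqrt k l al P - c%:P * psi_op_sqrt k l al Q.
Proof.
rewrite /psi_op_sqrt mul_polyC derivB !derivnB derivZ !derivnZ -!mul_polyC.
by move: (psi_c0 _ _ _ _) (psi_c1 _ _ _ _) => c0 c1; ring.
Qed.

(** Both sides are polynomial solutions of the third order equation in s, and
    c makes them agree at s = 1, where Psi is the nonzero prefactor. *)
Lemma G_mul_H : exists2 c : F, c != 0 & G * H = c%:P * (Psi \Po 'X^2).
Proof.
have pref0 := Psi_prefactor_neq0.
pose c := (G * H).[1] / Psi.[1].
have GH : G * H = c%:P * (Psi \Po 'X^2).
  apply/eqP; rewrite -subr_eq0; apply/eqP.
  apply: (psi_op_sqrt_uniq alpha_neq_nat alpha_neq_oppn (k := k) (l := l)).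
    rewrite psi_op_sqrtB psi_op_comp_sqr Psi_ode comp_poly0 !mulr0 subr0.
    apply: (dihedral_product f_inj Gpoly_ode).
    exact: dihedral_op_opp Gpoly_ode.
  rewrite hornerD hornerN [X in _ - X]hornerM hornerC horner_comp hornerXn.
  rewrite expr1n /c.
  by rewrite divfK ?subrr // Psi_at1.
exists c => //; apply/negP => /eqP c0.
move: GH; rewrite c0 polyC0 mul0r => /eqP.
by rewrite mulf_eq0 (negPf G_neq0) (negPf H_neq0).
Qed.

Lemma G_at1 : G.[1] != 0.
Proof.
have [c c0 GH] := G_mul_H.
have /(congr1 (fun p : {poly F} => p.[1])) := GH.
rewrite !hornerM hornerC !horner_comp hornerXn expr1n Psi_at1 => E.
apply/negP => /eqP G1; move/esym/eqP: E.
by rewrite G1 mul0r mulf_eq0 (negPf c0) (negPf Psi_prefactor_neq0).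
Qed.

Section Theta.
Variables T1 T2 : {poly F}.
Hypothesis T12 : Theta_decomposition k l m n T1 T2.

Lemma Theta_decomposition_opp :
  (1 - 'X) ^+ n * H ^+ m = (T1 \Po 'X^2) - 'X ^+ (2 * k + 1) * (T2 \Po 'X^2).
Proof.
have /(congr1 (comp_poly (- 'X))) := T12.
rewrite rmorphD !rmorphM !rmorphXn rmorphD rmorph1 /= comp_polyX => ->.
rewrite -!comp_polyA comp_Xn_poly sqrrN exprNn.
by rewrite -signr_odd oddD oddM /= expr1 mulN1r mulNr.
Qed.

Lemma Theta_difference : (1 + 'X) ^+ n * G ^+ m - (1 - 'X) ^+ n * H ^+ m
  = 2 * 'X ^+ (2 * k + 1) * (T2 \Po 'X^2).
Proof. by rewrite T12 Theta_decomposition_opp; ring. Qed.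

(** If Theta_2 vanished, (1 + s)^n G^m would be even; it is zero at s = -1 but
    not at s = 1, where G H = c Psi is nonzero. *)
Lemma Theta2_neq0 : T2 != 0.
Proof.
apply/negP => /eqP T20; have := Theta_difference.
rewrite T20 comp_poly0 mulr0 => /(congr1 (fun p : {poly F} => p.[-1])).
rewrite hornerD hornerN !hornerM !horner_exp !hornerD !hornerN hornerX.
rewrite horner_comp hornerN hornerX opprK horner0.
rewrite -polyC1 hornerC subrr expr0n.
rewrite (gtn_eqF n_gt0) mul0r sub0r => /eqP.
rewrite oppr_eq0 mulf_eq0 !expf_eq0 (negPf G_at1) andbF orbF.
by rewrite -[1 + 1]/(2 : F) pnatr_eq0 andbF.
Qed.

Lemma Theta2_ode : theta_form k%:R l%:R m%:R n%:R 'X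
  Psi Psi^`() Psi^`(2) T2 T2^`() T2^`(2) = 0.
Proof.
have [c c0 GH] := G_mul_H.
apply: (theta_form_eq0 f_inj m_gt0 c0 G_neq0 H_neq0 Gpoly_ode _ GH).
  exact: dihedral_op_opp Gpoly_ode.
exact: Theta_difference.
Qed.
End Theta.

Let natK i : (i.+1%:R : K) != 0.
Proof. by rewrite -(rmorph_nat (f \o polyC)) fmorph_eq0 pnatr_eq0. Qed.

Let alK : f al%:P = n%:R / m%:R.
Proof. by rewrite -[LHS]/((f \o polyC) _) fmorph_div !rmorph_nat. Qed.

Let mK : (m%:R : K) != 0. Proof. by case: (m) m_gt0. Qed.

(** The polynomial identities divided by x - 1, by 2 x^2 (x - 1)^2 and by
    4 x (x - 1) Psi Theta_2; f stands for the inclusion of F[x] in F(x). *)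
Lemma relations_in_field :
  let x := f 'X in
  let kk := k%:R : K in
  let ll := l%:R : K in
  let mm := m%:R : K in
  let nn := n%:R : K in
  let Y := f Psi in
  let Y1 := f Psi^`() in
  let Y2 := f Psi^`(2) in
  let Y3 := f Psi^`(3) in
  let Y_at1 := f (Psi.[1])%:P in
  [/\ x * (x - 1) * (Y1 ^+ 2 - 2 * Y2 * Y)
        + ((2 * kk - 3) * x - 2 * kk + 1) * Y1 * Y
      = ((kk + ll) * (kk - ll - 1) - nn ^+ 2 / (mm ^+ 2 * (x - 1))) * Y ^+ 2
        + nn ^+ 2 * Y_at1 ^+ 2 * x ^+ (2 * k) / (mm ^+ 2 * (x - 1)),
      Y3
      = 3 * ((kk - 1 / 2) / x - 1 / (x - 1)) * Y2
        - (kk * (2 * kk - 1) / x ^+ 2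
           + (mm ^+ 2 - nn ^+ 2) / (mm ^+ 2 * (x - 1) ^+ 2)
           + (kk ^+ 2 - ll ^+ 2 - 5 * kk - ll + 2 + nn ^+ 2 / mm ^+ 2)
             / (x * (x - 1))) * Y1
        + ((kk + ll) * (kk - ll - 1) * (2 * kk - 1) * x
           - 2 * kk * ((kk + ll) * (kk - ll - 1) + nn ^+ 2 / mm ^+ 2))
          / (2 * x ^+ 2 * (x - 1) ^+ 2) * Y,
      Psi != 0
    & forall Theta1 Theta2 : {poly F},
      Theta_decomposition k l m n Theta1 Theta2 ->
      let T := f Theta2 in
      let T1 := f Theta2^`() in
      let T2 := f Theta2^`(2) in
      Theta2 != 0 /\
      T2 / T
      + ((kk + 3 / 2) / x - (nn - 1) / (x - 1) - (mm - 1) * Y1 / Y) * (T1 / T)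
      + mm * (mm - 1) / 2 * (Y2 / Y)
      - (mm - 1) / 4
        * ((mm * (2 * kk - 1) + 4 * kk + 2) / x - 2 * (mm + nn) / (x - 1))
        * (Y1 / Y)
      + (mm ^+ 2 * (kk + ll) * (kk - ll - 1)
         + (nn - 2) * (nn - 2 * kk - 1)) / (4 * x * (x - 1)) = 0].
Proof.
move=> x kk ll mm nn Y Y1 Y2 Y3 Y_at1.
have Psi0 : Psi != 0.
  apply/eqP => P0; have := Psi_at1; rewrite P0 horner0 => /esym/eqP.
  by rewrite (negPf Psi_prefactor_neq0).
have [K2 K4] : (2 : K) != 0 /\ (4 : K) != 0 by split; apply: natK.
split=> //.
- have /(congr1 f) := psi_first_integral Psi_ode.
  rewrite -mul_polyC [(al ^+ 2 * _)%:P]polyCM !polyC_exp.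
  rewrite !fE alK -/x -/Y -/Y1 -/Y2 -/Y_at1 -/kk -/ll -/mm -/nn => E.
  apply: (mulfI x1); apply: (eq_of_multiple 1 E).
  by field; rewrite x1 mK.
- have /(congr1 f) := Psi_ode; rewrite /psi_op /psi_c0 /psi_c1.
  rewrite rmorph0 !fE alK -/x -/Y -/Y1 -/Y2 -/Y3 -/kk -/ll -/mm -/nn => E.
  have w0 : 2 * x ^+ 2 * (x - 1) ^+ 2 != 0 by rewrite !mulf_neq0 ?expf_neq0.
  apply: (mulfI w0); apply: (eq_of_multiple 1 E).
  by field; rewrite x0 x1 mK K2.
move=> Theta1 Theta2 dec T T1 T2; split; first exact: Theta2_neq0 dec.
have Y0 : Y != 0 by exact: f_neq0.
have T0 : T != 0 by apply/f_neq0/(Theta2_neq0 dec).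
have /(congr1 f) := Theta2_ode dec.
rewrite rmorph0 rmorph_theta_form !rmorph_nat /theta_form.
rewrite -/x -/Y -/Y1 -/Y2 -/T -/T1 -/T2 -/kk -/ll -/mm -/nn => E.
have w0 : 4 * x * (x - 1) * Y * T != 0 by rewrite !mulf_neq0.
apply: (mulfI w0); apply: (eq_of_multiple 1 E).
by field; rewrite ?x0 ?x1 ?K2 ?K4 ?Y0 ?T0.
Qed.
End Frac.
End Facts.

(* All identities are between elements of the field F(x) of rational functions;
   kk, ll, mm, nn are the images of k, l, m, n in F(x). *)
Theorem theorem5p7 (F : numFieldType) (k l m n : nat)
  (k_gt0 : (0 < k)%N) (l_gt0 : (0 < l)%N) (n_gt0 : (0 < n)%N)
  (m_gt1 : (1 < m)%N) (co_nm : gcdn n m = 1%N) :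
  let x := ('X : {poly F})%:F in
  let kk := k%:R : {fraction {poly F}} in
  let ll := l%:R : {fraction {poly F}} in
  let mm := m%:R : {fraction {poly F}} in
  let nn := n%:R : {fraction {poly F}} in
  let Y := (Psi F k l m n)%:F in
  let Y1 := ((Psi F k l m n)^`())%:F in
  let Y2 := ((Psi F k l m n)^`(2))%:F in
  let Y3 := ((Psi F k l m n)^`(3))%:F in
  let Y_at1 := ((Psi F k l m n).[1])%:P%:F in
  [/\ x * (x - 1) * (Y1 ^+ 2 - 2 * Y2 * Y)
        + ((2 * kk - 3) * x - 2 * kk + 1) * Y1 * Y
      = ((kk + ll) * (kk - ll - 1) - nn ^+ 2 / (mm ^+ 2 * (x - 1))) * Y ^+ 2
        + nn ^+ 2 * Y_at1 ^+ 2 * x ^+ (2 * k) / (mm ^+ 2 * (x - 1)),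
      Y3
      = 3 * ((kk - 1 / 2) / x - 1 / (x - 1)) * Y2
        - (kk * (2 * kk - 1) / x ^+ 2
           + (mm ^+ 2 - nn ^+ 2) / (mm ^+ 2 * (x - 1) ^+ 2)
           + (kk ^+ 2 - ll ^+ 2 - 5 * kk - ll + 2 + nn ^+ 2 / mm ^+ 2)
             / (x * (x - 1))) * Y1
        + ((kk + ll) * (kk - ll - 1) * (2 * kk - 1) * x
           - 2 * kk * ((kk + ll) * (kk - ll - 1) + nn ^+ 2 / mm ^+ 2))
          / (2 * x ^+ 2 * (x - 1) ^+ 2) * Y,
      (* Psi and Theta2 are nonzero, so that the quotients below are genuine *)
      Psi F k l m n != 0
    & forall Theta1 Theta2 : {poly F},
      Theta_decomposition k l m n Theta1 Theta2 ->
      let T := Theta2%:F in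
      let T1 := (Theta2^`())%:F in
      let T2 := (Theta2^`(2))%:F in
      Theta2 != 0 /\
      T2 / T
      + ((kk + 3 / 2) / x - (nn - 1) / (x - 1) - (mm - 1) * Y1 / Y) * (T1 / T)
      + mm * (mm - 1) / 2 * (Y2 / Y)
      - (mm - 1) / 4
        * ((mm * (2 * kk - 1) + 4 * kk + 2) / x - 2 * (mm + nn) / (x - 1))
        * (Y1 / Y)
      + (mm ^+ 2 * (kk + ll) * (kk - ll - 1)
         + (nn - 2) * (nn - 2 * kk - 1)) / (4 * x * (x - 1)) = 0].
Proof.
have tofrac_inj : injective (@FracField.tofrac {poly F}).
  by move=> p q /eqP; rewrite tofrac_eq => /eqP.
exact: (relations_in_field k l n_gt0 m_gt1 co_nm tofrac_inj).
Qed.
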